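(* Let $(A,\rho_\Omega,\tau_\Omega)$ be an $\Omega$-MTRBA and $B=\mathbf{k}\oplus B^+$ an augmented $\mathbf{k}$-algebra. Then the $\mathbf{k}$-module $$F_{\mathrm{MRBA}}(A,B)=\bigoplus_{k\ge0}\mathfrak{A}\otimes(\mathbf{k}\Omega\otimes\mathfrak{A}^+)^{\otimes k},\qquad \mathfrak{A}=A\otimes B,\ \mathfrak{A}^+=A\otimes B^+,$$ with the multiplication $\circledast$, the linear operators $P_{F,\Omega}^{\tau_{F,\Omega}}=(P_{F,\omega}^{\tau_{F,\omega}}\mid\omega\in\Omega)$, the twist $\tau_{F,\Omega}:=j_F(\tau_\Omega)$, the natural inclusion $j_F:A\to F_{\mathrm{MRBA}}(A,B)$, and $i_B:B\to F_{\mathrm{MRBA}}(A,B)$, $b\mapsto 1_A\otimes b\in\mathfrak{A}$ (all as defined in the context), is the free $(A,\rho_\Omega,\tau_\Omega)$-MTRBA over $B$.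
   Context: $\mathbf{k}$ is a field of characteristic $0$; all algebras are commutative unital $\mathbf{k}$-algebras (except augmentation parts), tensor products are over $\mathbf{k}$. $\Omega$ is a nonempty set and $\mathbf{k}\Omega$ is the vector space with basis $\Omega$. An augmented $\mathbf{k}$-algebra is an algebra $B=\mathbf{k}\oplus B^+$ (direct sum of $\mathbf{k}$-subalgebras, $B^+$ not required unital). An $\Omega$-MTRBA (matching twisted Rota-Baxter algebra, of weight $0$) $(R,P_\Omega,\tau_\Omega)$ is an algebra $R$ with linear operators $P_\omega:R\to R$ and invertible elements $\tau_\omega\in R$, $\omega\in\Omega$, such that for all $x,y\in R$, $\alpha,\beta\in\Omega$, $$P_\alpha(x)P_\beta(y)=\tau_\alpha P_\beta(\tau_\alpha^{-1}P_\alpha(x)y)+\tau_\beta P_\alpha(\tau_\beta^{-1}xP_\beta(y)).$$ An $\Omega$-MTRBA homomorphism $(R,P_\Omega,\tau_\Omega)\to(R',P'_\Omega,\tau'_\Omega)$ is an algebra homomorphism $\varphi$ with $\varphi(\tau_\omega)=\tau'_\omega$ and $\varphi P_\omega=P'_\omega\varphi$ for all $\omega$. For a fixed $\Omega$-MTRBA $(A,\rho_\Omega,\tau_\Omega)$, an $(A,\rho_\Omega,\tau_\Omega)$-MTRBA is an $\Omega$-MTRBA $(R,P_\Omega,\tau_{R,\Omega})$ with an $\Omega$-MTRBA homomorphism $j_R:A\to R$; homomorphisms of these are $\Omega$-MTRBA homomorphisms $f$ with $fj_{1}=j_{2}$. The free $(A,\rho_\Omega,\tau_\Omega)$-MTRBA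 over $B$ is an $(A,\rho_\Omega,\tau_\Omega)$-MTRBA $F$ with an algebra homomorphism $i_B:B\to F$ such that for every $(A,\rho_\Omega,\tau_\Omega)$-MTRBA $R$ and every algebra homomorphism $f:B\to R$ there is a unique $(A,\rho_\Omega,\tau_\Omega)$-MTRBA homomorphism $\bar f:F\to R$ with $f=\bar f\,i_B$. Notation: $\mathfrak{A}=A\otimes B=A\oplus\mathfrak{A}^+$ ($A$ identified with $A\otimes 1$). Put $\phi_\omega(u):=\tau_\omega^{-1}\rho_\omega(\tau_\omega u)$ for $u\in A$. In the formulas below, $\mathfrak{u}=u_0\otimes(\omega_1\otimes u_1)\otimes\cdots\otimes(\omega_n\otimes u_n)$ is a pure tensor with $n\ge0$, $u_0\in\mathfrak{A}$, $u_i\in\mathfrak{A}^+$ and $\omega_i\in\Omega$ for $1\le i\le n$; operators are defined when $u_0\in A$ or $u_0\in\mathfrak{A}^+$ and extended linearly. Operators $P_{F,\omega}$: $P_{F,\omega}(\mathfrak{u})=\phi_\omega(u_0)$ if $u_0\in A$, $n=0$; $P_{F,\omega}(\mathfrak{u})=\phi_\omega(u_0)\otimes(\omega_1\otimes u_1)\otimes\cdots\otimes(\omega_n\otimes u_n)-1_A\otimes(\omega_1\otimes\phi_\omega(u_0)u_1)\otimes(\omega_2\otimes u_2)\otimes\cdots\otimes(\omega_n\otimes u_n)$ if $u_0\in A$, $n>0$; $P_{F,\omega}(\mathfrak{u})=1_A\otimes(\omega\otimes u_0)\otimes(\omega_1\otimes u_1)\otimes\cdots\otimes(\omega_n\otimes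 u_n)$ if $u_0\in\mathfrak{A}^+$. Multiplication $\circledast$: for $n>0$, $\mathfrak{u}=u_0P_{F,\omega_1}(\mathfrak{u}')$ with $\mathfrak{u}'=u_1\otimes(\omega_2\otimes u_2)\otimes\cdots\otimes(\omega_n\otimes u_n)$, where $u_0\in\mathfrak{A}$ multiplies the first tensor factor. For $\mathfrak{u}=u_0\otimes(\omega_1\otimes u_1)\otimes\cdots\otimes(\omega_m\otimes u_m)$ and $\mathfrak{v}=v_0\otimes(\varepsilon_1\otimes v_1)\otimes\cdots\otimes(\varepsilon_n\otimes v_n)$ define recursively $\mathfrak{u}\circledast\mathfrak{v}=u_0v_0$ if $m=n=0$; $\mathfrak{u}\circledast\mathfrak{v}=u_0v_0\otimes(\varepsilon_1\otimes v_1)\otimes\cdots\otimes(\varepsilon_n\otimes v_n)$ if $m=0,n>0$; $\mathfrak{u}\circledast\mathfrak{v}=u_0v_0\otimes(\omega_1\otimes u_1)\otimes\cdots\otimes(\omega_m\otimes u_m)$ if $m>0,n=0$; $\mathfrak{u}\circledast\mathfrak{v}=u_0v_0P_{F,\varepsilon_1}\big(P_{F,\omega_1}(\mathfrak{u}')\circledast\mathfrak{v}'\big)+u_0v_0P_{F,\omega_1}\big(\mathfrak{u}'\circledast P_{F,\varepsilon_1}(\mathfrak{v}')\big)$ if $m,n>0$; extended bilinearly. Operators $P_{F,\omega}^{\tau_{F,\omega}}$ (where $P_{F,\omega}^{\tau_{F,\omega}}(\mathfrak{u})=\tau_{F,\omega}P_{F,\omega}(\tau_{F,\omega}^{-1}\mathfrak{u})$),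 explicitly: $\rho_\omega(u_0)$ if $u_0\in A$, $n=0$; $\rho_\omega(u_0)\otimes(\omega_1\otimes u_1)\otimes\cdots\otimes(\omega_n\otimes u_n)-\tau_\omega\otimes(\omega_1\otimes\tau_\omega^{-1}\rho_\omega(u_0)u_1)\otimes(\omega_2\otimes u_2)\otimes\cdots\otimes(\omega_n\otimes u_n)$ if $u_0\in A$, $n>0$; $\tau_\omega\otimes(\omega\otimes\tau_\omega^{-1}u_0)\otimes(\omega_1\otimes u_1)\otimes\cdots\otimes(\omega_n\otimes u_n)$ if $u_0\in\mathfrak{A}^+$. $j_F:A\to\mathfrak{A}\subseteq F_{\mathrm{MRBA}}(A,B)$ is the natural inclusion and $\tau_{F,\omega}=j_F(\tau_\omega)$. *)

(* Defs.v *)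
From HB Require Import structures.
From mathcomp Require Import all_boot all_algebra.
From mathcomp Require Import boolp.

Set Implicit Arguments.
Unset Strict Implicit.
Unset Printing Implicit Defensive.

Import GRing.Theory.
Local Open Scope ring_scope.
Local Open Scope quotient_scope.

Record comalg_axioms (K : pzRingType) (V : lmodType K) (mul : V -> V -> V)
    (one : V) : Prop := ComAlgAxioms {
  comalg_mulA : associative mul;
  comalg_mulC : commutative mul;
  comalg_mul1 : left_id one mul;
  comalg_mulDl : left_distributive mul +%R;
  comalg_scaleAl : forall (c : K) x y, c *: mul x y = mul (c *: x) y
}.

(* The library's comAlgType excludes the zero ring; comalg does not. *)
Record comalg (K : pzRingType) := ComAlg {
  comalg_base : lmodType K;
  comalg_mul : comalg_base -> comalg_base -> comalg_base;
  comalg_one : comalg_base;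
  comalgP : comalg_axioms comalg_mul comalg_one
}.

Definition comalg_sort (K : pzRingType) (A : comalg K) : Type := comalg_base A.

Section ComAlgTheory.
Variables (K : pzRingType) (A : comalg K).

HB.instance Definition _ := GRing.Lmodule.on (comalg_sort A).
HB.instance Definition _ := GRing.Zmodule_isComPzRing.Build (comalg_sort A)
  (comalg_mulA (comalgP A)) (comalg_mulC (comalgP A))
  (comalg_mul1 (comalgP A)) (comalg_mulDl (comalgP A)).

Definition comalg_lmod : lmodType K := comalg_sort A.

End ComAlgTheory.

Coercion comalg_lmod : comalg >-> GRing.Lmodule.type.
Coercion comalg_sort : comalg >-> Sortclass.

Lemma calg_scalerAl (K : pzRingType) (A : comalg K) (c : K) (x y : A) :
  c *: (x * y) = (c *: x) * y.
Proof. exact: (comalg_scaleAl (comalgP A)). Qed.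

Lemma calg_scalerAr (K : pzRingType) (A : comalg K) (c : K) (x y : A) :
  c *: (x * y) = x * (c *: y).
Proof. by rewrite mulrC calg_scalerAl mulrC. Qed.

Definition alg_hom (K : pzRingType) (R S : comalg K) (f : R -> S) : Prop :=
  linear f /\ monoid_morphism f.

Section Submodule.
Variables (K : pzRingType) (V : lmodType K) (S : submodClosed V).

Record submod := Submod { submod_val :> V; _ : submod_val \in S }.

HB.instance Definition _ := [isSub for submod_val].
HB.instance Definition _ := [Choice of submod by <:].
HB.instance Definition _ := [SubChoice_isSubLmodule of submod by <:].

End Submodule.

Section QuotientModule.
Variables (K : pzRingType) (V : lmodType K) (S : submodClosed V).

Definition quotmod_pred : {pred V} := fun x => x \in S.

Fact quotmod_pred_closed : zmod_closed quotmod_pred.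
Proof. exact: GRing.submod_closedB (submodClosedP S). Qed.

HB.instance Definition _ :=
  GRing.isZmodClosed.Build V quotmod_pred quotmod_pred_closed.

Definition quotmod : Type := Quotient.quot quotmod_pred.

HB.instance Definition _ := GRing.Zmodule.on quotmod.
HB.instance Definition _ := EqQuotient.on quotmod.

Definition quotmod_pi (x : V) : quotmod := \pi x.

Lemma quotmod_pi_eq (x y : V) : (quotmod_pi x = quotmod_pi y) <-> (x - y \in S).
Proof.
have E := Quotient.idealrBE quotmod_pred x y.
by split=> [/eqP|xy]; [rewrite -E|apply/eqP; rewrite -E].
Qed.

Lemma quotmod_piD : {morph quotmod_pi : x y / x + y}.
Proof. by move=> x y; rewrite /quotmod_pi !piE. Qed.

Definition quotmod_scale (c : K) (x : quotmod) : quotmod :=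
  quotmod_pi (c *: repr x).

Lemma quotmod_reprK (x : quotmod) : quotmod_pi (repr x) = x.
Proof. exact: reprK. Qed.

Lemma quotmod_piZ c x : quotmod_pi (c *: x) = quotmod_scale c (quotmod_pi x).
Proof.
apply/quotmod_pi_eq; rewrite -scalerBr rpredZ //.
by apply/quotmod_pi_eq; rewrite quotmod_reprK.
Qed.

Fact quotmod_scaleA a b x :
  quotmod_scale a (quotmod_scale b x) = quotmod_scale (a * b) x.
Proof. by rewrite -[x]quotmod_reprK -!quotmod_piZ scalerA. Qed.

Fact quotmod_scale1 : left_id 1 quotmod_scale.
Proof. by move=> x; rewrite -[x]quotmod_reprK -!quotmod_piZ scale1r. Qed.

Fact quotmod_scaleDr : right_distributive quotmod_scale +%R.
Proof.
move=> a x y; rewrite -[x]quotmod_reprK -[y]quotmod_reprK.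
by rewrite -quotmod_piD -!quotmod_piZ scalerDr quotmod_piD.
Qed.

Fact quotmod_scaleDl x : {morph quotmod_scale^~ x : a b / a + b}.
Proof.
move=> a b; rewrite -[x]quotmod_reprK.
by rewrite -!quotmod_piZ scalerDl quotmod_piD.
Qed.

HB.instance Definition _ := GRing.Zmodule_isLmodule.Build K quotmod
  quotmod_scaleA quotmod_scale1 quotmod_scaleDr quotmod_scaleDl.

Fact quotmod_pi_linear : linear quotmod_pi.
Proof. by move=> c x y; rewrite quotmod_piD quotmod_piZ. Qed.

HB.instance Definition _ :=
  GRing.isLinear.Build K V quotmod *:%R quotmod_pi quotmod_pi_linear.

End QuotientModule.

Section Span.
Variables (K : pzRingType) (V : lmodType K) (G : V -> Prop).

Inductive in_span : V -> Prop :=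
| in_span0 : in_span 0
| in_spanD c x y : G x -> in_span y -> in_span (c *: x + y).

Definition span : {pred V} := fun x => `[< in_span x >].

Fact span_closed : submod_closed span.
Proof.
split=> [|c x y /asboolP sx /asboolP sy]; apply/asboolP; first exact: in_span0.
elim: sx => [|d z t Gz _ IH]; first by rewrite scaler0 add0r.
by rewrite scalerDr scalerA -addrA; exact: in_spanD.
Qed.

HB.instance Definition _ := GRing.isSubmodClosed.Build K V span span_closed.

Definition span_submod : submodClosed V := span.

End Span.

Section DirectSum.
Variables (K : pzRingType) (I : choiceType) (V : I -> lmodType K).

Definition fin_supp (f : forall i, V i) : Prop :=
  exists s : seq I, forall i, i \notin s -> f i = 0.

Record dsum := Dsum { dsum_fun :> forall i, V i; _ : `[< fin_supp dsum_fun >] }.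

HB.instance Definition _ := [isSub for dsum_fun].
HB.instance Definition _ := [Choice of dsum by <:].

Implicit Types x y : dsum.

Lemma dsumP x : fin_supp x. Proof. by case: x => f fP; exact/asboolP. Qed.

Lemma dsum_eq x y : (forall i, x i = y i) -> x = y.
Proof. by move=> e; apply: val_inj; apply: functional_extensionality_dep. Qed.

Fact dsum_zero_fin : `[< fin_supp (fun i => 0) >].
Proof. by apply/asboolP; exists [::]. Qed.
Definition dsum_zero := Dsum dsum_zero_fin.

Fact dsum_opp_fin x : `[< fin_supp (fun i => - x i) >].
Proof.
by apply/asboolP; case: (dsumP x) => s xs; exists s => i /xs->; rewrite oppr0.
Qed.
Definition dsum_opp x := Dsum (dsum_opp_fin x).

Fact dsum_add_fin x y : `[< fin_supp (fun i => x i + y i) >].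
Proof.
apply/asboolP; case: (dsumP x) (dsumP y) => s xs [t yt]; exists (s ++ t) => i.
by rewrite mem_cat negb_or => /andP[/xs-> /yt->]; rewrite addr0.
Qed.
Definition dsum_add x y := Dsum (dsum_add_fin x y).

Fact dsum_scale_fin (c : K) x : `[< fin_supp (fun i => c *: x i) >].
Proof.
by apply/asboolP; case: (dsumP x) => s xs; exists s => i /xs->; rewrite scaler0.
Qed.
Definition dsum_scale c x := Dsum (dsum_scale_fin c x).

Fact dsum_addA : associative dsum_add.
Proof. by move=> x y z; apply: dsum_eq => i; exact: addrA. Qed.
Fact dsum_addC : commutative dsum_add.
Proof. by move=> x y; apply: dsum_eq => i; exact: addrC. Qed.
Fact dsum_add0 : left_id dsum_zero dsum_add.
Proof. by move=> x; apply: dsum_eq => i; exact: add0r. Qed.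
Fact dsum_addN : left_inverse dsum_zero dsum_opp dsum_add.
Proof. by move=> x; apply: dsum_eq => i; exact: addNr. Qed.

HB.instance Definition _ :=
  GRing.isZmodule.Build dsum dsum_addA dsum_addC dsum_add0 dsum_addN.

Fact dsum_scaleA a b x : dsum_scale a (dsum_scale b x) = dsum_scale (a * b) x.
Proof. by apply: dsum_eq => i; exact: scalerA. Qed.
Fact dsum_scale1 : left_id 1 dsum_scale.
Proof. by move=> x; apply: dsum_eq => i; exact: scale1r. Qed.
Fact dsum_scaleDr : right_distributive dsum_scale +%R.
Proof. by move=> a x y; apply: dsum_eq => i; exact: scalerDr. Qed.
Fact dsum_scaleDl x : {morph dsum_scale^~ x : a b / a + b}.
Proof. by move=> a b; apply: dsum_eq => i; exact: scalerDl. Qed.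

HB.instance Definition _ := GRing.Zmodule_isLmodule.Build K dsum
  dsum_scaleA dsum_scale1 dsum_scaleDr dsum_scaleDl.

Lemma dsum0E i : (0 : dsum) i = 0. Proof. by []. Qed.
Lemma dsumDE x y i : (x + y) i = x i + y i. Proof. by []. Qed.
Lemma dsumZE c x i : (c *: x) i = c *: x i. Proof. by []. Qed.

Fact dinj_fin i (v : V i) : `[< fin_supp (dfwith (fun j => 0 : V j) v) >].
Proof.
apply/asboolP; exists [:: i] => j; rewrite inE eq_sym => ij.
exact: dfwith_out.
Qed.

Definition dinj i (v : V i) : dsum := Dsum (dinj_fin v).

Lemma dinj_in i (v : V i) : dinj v i = v.
Proof. exact: dfwith_in. Qed.

Lemma dinj_out i (v : V i) j : i != j -> dinj v j = 0.
Proof. exact: dfwith_out. Qed.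

Fact dinj_linear i : linear (@dinj i).
Proof.
move=> c u v; apply: dsum_eq => j; rewrite dsumDE dsumZE.
have [<-|ij] := eqVneq i j; first by rewrite !dinj_in.
by rewrite !dinj_out // scaler0 addr0.
Qed.

HB.instance Definition _ i :=
  GRing.isLinear.Build K (V i) dsum *:%R (@dinj i) (@dinj_linear i).

Definition dsupp x : seq I := undup (projT1 (cid (dsumP x))).

Lemma dsupp_uniq x : uniq (dsupp x). Proof. exact: undup_uniq. Qed.

Lemma dsuppP x i : i \notin dsupp x -> x i = 0.
Proof. by rewrite mem_undup; case: cid => s /= xs /xs. Qed.

Variable U : lmodType K.

(* The linear map dsum -> U with components f i, when each f i is linear. *)
Definition dlift (f : forall i, V i -> U) (x : dsum) : U :=
  \sum_(i <- dsupp x) f i (x i).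

Variable f : forall i, V i -> U.
Hypothesis f_lin : forall i, linear (@f i).

Let f0 i : f (0 : V i) = 0.
Proof.
have := @f_lin i (-1) 0 0.
by rewrite scaler0 addr0 scaleN1r addNr.
Qed.

Lemma dliftE x s : uniq s -> (forall i, i \notin s -> x i = 0) ->
  dlift f x = \sum_(i <- s) f (x i).
Proof.
move=> us xs; rewrite /dlift.
rewrite (bigID (mem s)) /= [X in _ + X]big1 ?addr0; last first.
  by move=> i /xs->.
rewrite [RHS](bigID (mem (dsupp x))) /= [X in _ = _ + X]big1 ?addr0; last first.
  by move=> i /dsuppP->.
rewrite -[LHS]big_filter -[RHS]big_filter; apply: perm_big; apply: uniq_perm.
- exact/filter_uniq/dsupp_uniq.
- exact: filter_uniq.
by move=> i; rewrite !mem_filter /= andbC.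
Qed.

Lemma dlift_linear : linear (dlift f).
Proof.
move=> c x y; pose s := undup (dsupp x ++ dsupp y).
have us : uniq s by exact: undup_uniq.
have sx i : i \notin s -> x i = 0.
  by rewrite mem_undup mem_cat negb_or => /andP[/dsuppP].
have sy i : i \notin s -> y i = 0.
  by rewrite mem_undup mem_cat negb_or => /andP[_ /dsuppP].
rewrite (dliftE us sx) (dliftE us sy) (@dliftE (c *: x + y) s us); last first.
  by move=> i is_; rewrite dsumDE dsumZE sx // sy // scaler0 addr0.
rewrite scaler_sumr -big_split /=; apply: eq_bigr => i _.
exact: f_lin.
Qed.

Lemma dlift_dinj i (v : V i) : dlift f (dinj v) = f v.
Proof.
rewrite (@dliftE _ [:: i]) // ?big_seq1 ?dinj_in // => j.
by rewrite inE eq_sym; exact: dinj_out.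
Qed.

End DirectSum.

Definition regmod (K : pzRingType) : lmodType K := GRing.Lmodule.clone K K^o _.

Section FreeModule.
Variables (K : pzRingType) (I : choiceType).

Definition freemod : Type := dsum (fun _ : I => regmod K).

HB.instance Definition _ := GRing.Lmodule.on freemod.

Definition fbasis (i : I) : freemod :=
  @dinj K I (fun _ => regmod K) i (1 : K).

End FreeModule.

Section LinearPred.
Variables (K : pzRingType) (V U : lmodType K) (f : V -> U).
Hypothesis f_lin : linear f.

Lemma linD : {morph f : x y / x + y}.
Proof. by move=> x y; have := f_lin 1 x y; rewrite !scale1r. Qed.

Lemma lin0 : f 0 = 0.
Proof. by apply: (addrI (f 0)); rewrite -linD !addr0. Qed.

Lemma linZ c : {morph f : x / c *: x}.
Proof. by move=> x; have := f_lin c x 0; rewrite lin0 !addr0. Qed.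

Lemma linN : {morph f : x / - x}.
Proof. by move=> x; rewrite -!scaleN1r linZ. Qed.

End LinearPred.

Definition bilinear_map (K : pzRingType) (V W U : lmodType K)
    (f : V -> W -> U) : Prop :=
  (forall w, linear (f^~ w)) /\ (forall v, linear (f v)).

Section Tensor.
Variables (K : fieldType) (V W : lmodType K).

Definition tens_pairs : choiceType := (V * W)%type.

Local Notation FVW := (freemod K tens_pairs).
Local Notation e v w := (@fbasis K tens_pairs (v, w)).

Inductive tens_relator : FVW -> Prop :=
| tens_relator_l c v v' w :
    tens_relator (e (c *: v + v') w - (c *: e v w + e v' w))
| tens_relator_r c v w w' :
    tens_relator (e v (c *: w + w') - (c *: e v w + e v w')).

Definition tens : Type := quotmod (span_submod tens_relator).

HB.instance Definition _ := GRing.Lmodule.on tens.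

Definition tpair (v : V) (w : W) : tens := quotmod_pi (span_submod tens_relator) (e v w).

Lemma tpair_bilinear : bilinear_map tpair.
Proof.
split=> [w c v v'|v c w w']; rewrite /tpair -linearP; apply/quotmod_pi_eq.
  apply/asboolP; rewrite -[X in in_span _ X]addr0 -[X in X + 0]scale1r.
  by apply: in_spanD; [exact: tens_relator_l|exact: in_span0].
apply/asboolP; rewrite -[X in in_span _ X]addr0 -[X in X + 0]scale1r.
by apply: in_spanD; [exact: tens_relator_r|exact: in_span0].
Qed.

Variable U : lmodType K.

(* The linear map v (x) w |-> f v w, when f is bilinear. *)
Definition tlift (f : V -> W -> U) (t : tens) : U :=
  @dlift K tens_pairs (fun=> regmod K) U
    (fun p (c : K) => c *: f p.1 p.2) (repr t).

End Tensor.

Notation "v ⊗ w" := (tpair v w) (at level 40, left associativity) : ring_scope.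

Section TensorTheory.
Variables (K : fieldType) (V W : lmodType K).

Lemma tpairDl (v v' : V) (w : W) : (v + v') ⊗ w = v ⊗ w + v' ⊗ w.
Proof. exact: (linD ((tpair_bilinear V W).1 w)). Qed.

Lemma tpairDr (v : V) (w w' : W) : v ⊗ (w + w') = v ⊗ w + v ⊗ w'.
Proof. exact: (linD ((tpair_bilinear V W).2 v)). Qed.

Lemma tpairZl c (v : V) (w : W) : (c *: v) ⊗ w = c *: (v ⊗ w).
Proof. exact: (linZ ((tpair_bilinear V W).1 w)). Qed.

Lemma tpairZr c (v : V) (w : W) : v ⊗ (c *: w) = c *: (v ⊗ w).
Proof. exact: (linZ ((tpair_bilinear V W).2 v)). Qed.

Lemma freemodE (I : choiceType) (x : freemod K I) :
  x = \sum_(i <- dsupp x) (dsum_fun x i : K) *: fbasis K i.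
Proof.
apply: dsum_eq => j.
pose ev (z : freemod K I) : K := dsum_fun z j.
have ev_sum (s : seq I) (F : I -> freemod K I) :
    ev (\sum_(i <- s) F i) = \sum_(i <- s) ev (F i).
  by elim: s => [|i s IH]; rewrite ?big_nil // !big_cons -IH.
have evZ c i : ev (c *: fbasis K i) = c * (i == j)%:R.
  rewrite -[ev _]/(c * ev (fbasis K i)); congr (_ * _).
  rewrite /ev; have [<-|ij] := eqVneq i j; first exact: (@dinj_in K I (fun=> regmod K)).
  exact: (@dinj_out K I (fun=> regmod K)).
rewrite -[LHS]/(ev x) -[RHS]/(ev _) ev_sum.
rewrite (eq_bigr _ (fun i _ => evZ _ i)).
case: (boolP (j \in dsupp x)) => jx.
  rewrite (bigD1_seq j) ?dsupp_uniq //= big1 ?addr0 ?eqxx ?mulr1 //.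
  by move=> i /negPf->; rewrite mulr0.
rewrite [LHS](dsuppP jx) big_seq big1 // => i ix.
by rewrite (negPf (_ : i != j)) ?mulr0 //; apply: contraNneq jx => <-.
Qed.

Lemma freemod_ind (I : choiceType) (P : freemod K I -> Prop) :
  P 0 -> (forall c i x, P x -> P (c *: fbasis K i + x)) -> forall x, P x.
Proof.
move=> P0 PD x; rewrite [x]freemodE.
by elim: (dsupp x) => [|i s IH]; rewrite ?big_nil // big_cons; exact: PD.
Qed.

Lemma tens_ind (P : tens V W -> Prop) :
  P 0 -> (forall v w t, P t -> P (v ⊗ w + t)) -> forall t, P t.
Proof.
move=> P0 PD t; rewrite -[t]quotmod_reprK.
elim/freemod_ind: (repr t) => [|c [v w] x]; first by rewrite linear0.
rewrite linearP => Px.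
have := PD (c *: v) w _ Px.
by rewrite tpairZl.
Qed.

End TensorTheory.

Section TensorLift.
Variables (K : fieldType) (V W U : lmodType K).

Lemma tens_ext (f g : tens V W -> U) : linear f -> linear g ->
  (forall v w, f (v ⊗ w) = g (v ⊗ w)) -> f =1 g.
Proof.
move=> fl gl fg; elim/tens_ind => [|v w t IH]; first by rewrite !lin0.
by rewrite !linD // fg IH.
Qed.

Variable f : V -> W -> U.
Hypothesis f_bil : bilinear_map f.

Let g : freemod K (tens_pairs V W) -> U :=
  @dlift K (tens_pairs V W) (fun=> regmod K) U (fun p (c : K) => c *: f p.1 p.2).

Let g_lin : linear g.
Proof. by apply: dlift_linear => p c x y; rewrite scalerDl scalerA. Qed.

Let g_basis p : g (fbasis K p) = f p.1 p.2.
Proof.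
rewrite /g /fbasis dlift_dinj ?scale1r // => i c x y.
by rewrite scalerDl scalerA.
Qed.

Let g_span x : x \in span_submod (@tens_relator K V W) -> g x = 0.
Proof.
move=> /asboolP; elim=> [|c y z yrel _ IH]; first exact: lin0.
rewrite g_lin IH addr0; suff -> : g y = 0 by rewrite scaler0.
case: yrel => [d v v' w|d v w w']; rewrite (linD g_lin) (linN g_lin) (linD g_lin) (linZ g_lin).
  by rewrite !g_basis /= (f_bil.1 w) subrr.
by rewrite !g_basis /= (f_bil.2 v) subrr.
Qed.

Let tlift_pi x : tlift f (quotmod_pi (span_submod (@tens_relator K V W)) x) = g x.
Proof.
apply/eqP; rewrite -subr_eq0 -[_ - _]/(g _ - g x) -(linN g_lin) -(linD g_lin).
by apply/eqP/g_span/quotmod_pi_eq; rewrite quotmod_reprK.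
Qed.

Lemma tlift_linear : linear (tlift f).
Proof.
move=> c x y; rewrite -[x]quotmod_reprK -[y]quotmod_reprK.
have -> (s t : freemod K (tens_pairs V W)) :
    c *: (quotmod_pi (span_submod (@tens_relator K V W)) s : tens V W) +
    quotmod_pi (span_submod (@tens_relator K V W)) t =
    quotmod_pi (span_submod (@tens_relator K V W)) (c *: s + t).
  by rewrite linearP.
by rewrite !tlift_pi g_lin.
Qed.

Lemma tliftE v w : tlift f (v ⊗ w) = f v w.
Proof. by rewrite tlift_pi g_basis. Qed.

End TensorLift.

Section TensorAlgebra.
Variables (K : fieldType) (A B : comalg K).

Let amul (a : A) (b : B) (a' : A) (b' : B) : tens A B := (a * a') ⊗ (b * b').

Let amul_bil a b : bilinear_map (amul a b).
Proof.
split=> [b' c x y|a' c x y]; rewrite /amul.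
  by rewrite mulrDr -calg_scalerAr tpairDl tpairZl.
by rewrite mulrDr -calg_scalerAr tpairDr tpairZr.
Qed.

Definition tens_mul (x y : tens A B) : tens A B :=
  tlift (fun (a : A) (b : B) =>
    tlift (fun (a' : A) (b' : B) => (a * a') ⊗ (b * b')) y) x.

Let tens_mul_bil y : bilinear_map (fun (a : A) (b : B) => tlift (amul a b) y).
Proof.
split=> [b c a a'|a c b b'].
  apply: (tens_ext (f := tlift (amul (c *: a + a') b))
    (g := fun y => c *: tlift (amul a b) y + tlift (amul a' b) y)) => {y}.
  - exact: tlift_linear.
  - move=> d y z; rewrite !tlift_linear // !scalerDr !scalerA (mulrC c d).
    by rewrite addrACA.
  move=> v w; rewrite !tliftE // /amul mulrDl -calg_scalerAl.
  by rewrite tpairDl tpairZl.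
apply: (tens_ext (f := tlift (amul a (c *: b + b')))
    (g := fun y => c *: tlift (amul a b) y + tlift (amul a b') y)) => {y}.
- exact: tlift_linear.
- move=> d y z; rewrite !tlift_linear // !scalerDr !scalerA (mulrC c d).
  by rewrite addrACA.
move=> v w; rewrite !tliftE // /amul mulrDl -calg_scalerAl.
by rewrite tpairDr tpairZr.
Qed.

Lemma tens_mul_bilinear : bilinear_map tens_mul.
Proof.
split=> [y|x]; first exact: (tlift_linear (tens_mul_bil y)).
move=> c y z; apply: (tens_ext (f := tens_mul^~ (c *: y + z))
  (g := fun x => c *: tens_mul x y + tens_mul x z)) => {x}.
- exact: (tlift_linear (tens_mul_bil _)).
- move=> d u v; rewrite /tens_mul !(tlift_linear (tens_mul_bil _)).
  by rewrite !scalerDr !scalerA (mulrC c d) addrACA.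
by move=> a b; rewrite /tens_mul !(tliftE (tens_mul_bil _)) tlift_linear.
Qed.

Lemma tens_mulE a b a' b' :
  tens_mul (a ⊗ b) (a' ⊗ b') = (a * a') ⊗ (b * b').
Proof. by rewrite /tens_mul (tliftE (tens_mul_bil _)) tliftE. Qed.

Let mulDl x y z : tens_mul (x + y) z = tens_mul x z + tens_mul y z.
Proof. exact: (linD (tens_mul_bilinear.1 z)). Qed.
Let mulDr x y z : tens_mul x (y + z) = tens_mul x y + tens_mul x z.
Proof. exact: (linD (tens_mul_bilinear.2 x)). Qed.
Let mul0l x : tens_mul 0 x = 0.
Proof. exact: (lin0 (tens_mul_bilinear.1 x)). Qed.
Let mul0r x : tens_mul x 0 = 0.
Proof. exact: (lin0 (tens_mul_bilinear.2 x)). Qed.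

Lemma tens_comalg : comalg_axioms tens_mul ((1 : A) ⊗ (1 : B)).
Proof.
split.
- move=> x y z.
  elim/tens_ind: x => [|a b x IHx]; first by rewrite !mul0l.
  rewrite !mulDl IHx; congr (_ + _).
  elim/tens_ind: y {IHx} => [|a' b' y IHy]; first by rewrite !(mul0l, mul0r).
  rewrite mulDl !mulDr mulDl IHy; congr (_ + _).
  elim/tens_ind: z {IHy} => [|u v z IHz]; first by rewrite !mul0r.
  by rewrite !mulDr IHz !tens_mulE !mulrA.
- move=> x y; elim/tens_ind: x => [|a b x IHx]; first by rewrite mul0l mul0r.
  rewrite mulDl mulDr IHx; congr (_ + _).
  elim/tens_ind: y {IHx} => [|a' b' y IHy]; first by rewrite mul0l mul0r.
  by rewrite mulDl mulDr IHy !tens_mulE (mulrC a) (mulrC b).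
- elim/tens_ind => [|a b x IHx]; first exact: mul0r.
  by rewrite mulDr IHx tens_mulE !mul1r.
- by move=> x y z; exact: mulDl.
- by move=> c x y; rewrite -(linZ (tens_mul_bilinear.1 y)).
Qed.

Definition talg : comalg K := ComAlg tens_comalg.

End TensorAlgebra.

Section MTRBA.
Variables (K : pzRingType) (Omega : Type).

(* The inverses tau_w^-1 are part of the data, being unique. *)
Record is_mtrba (R : comalg K) (P : Omega -> R -> R) (tau tauV : Omega -> R) :
    Prop := IsMtrba {
  mtrba_linear : forall w, linear (P w);
  mtrba_tauV : forall w, tau w * tauV w = 1;
  mtrba_eq : forall a b x y,
    P a x * P b y = tau a * P b (tauV a * P a x * y)
                  + tau b * P a (tauV b * x * P b y)
}.

Record mtrba := Mtrba {
  mt_alg :> comalg K;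
  mt_op : Omega -> mt_alg -> mt_alg;
  mt_tau : Omega -> mt_alg;
  mt_tauV : Omega -> mt_alg;
  mtrbaP : is_mtrba mt_op mt_tau mt_tauV
}.

Definition mtrba_hom (R S : mtrba) (f : R -> S) : Prop :=
  [/\ alg_hom f,
      forall w, f (mt_tau R w) = mt_tau S w &
      forall w x, f (mt_op w x) = mt_op w (f x)].

(* (F, j) is the free (A, rho, tau)-MTRBA over B, through i : B -> F. *)
Record is_free_mtrba (A : mtrba) (B : comalg K) (F : mtrba)
    (j : A -> F) (i : B -> F) : Prop := IsFreeMtrba {
  free_struct_hom : mtrba_hom j;
  free_incl_hom : alg_hom i;
  free_univ : forall (R : mtrba) (jR : A -> R), mtrba_hom jR ->
    forall f : B -> R, alg_hom f ->
    exists! g : F -> R,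
      [/\ mtrba_hom g, forall a, g (j a) = jR a & forall b, f b = g (i b)]
}.

End MTRBA.

Section Augmented.
Variables (K : pzRingType) (B : comalg K) (Bp : submodClosed B).

Record augmentation : Prop := Augmentation {
  aug_mul : forall x y : B, x \in Bp -> y \in Bp -> x * y \in Bp;
  aug_sum : forall b : B, exists c : K, exists2 b' : B,
    b' \in Bp & b = c *: (1 : B) + b';
  aug_cap : forall c : K, c *: (1 : B) \in Bp -> c = 0
}.

End Augmented.

Fixpoint tpow (K : fieldType) (W : lmodType K) (n : nat) : lmodType K :=
  if n is m.+1 then tens W (tpow W m) else regmod K.

Section FreeConstruction.
Variables (K : fieldType) (Omega : choiceType) (A : mtrba K Omega).
Variables (B : comalg K) (Bp : submodClosed B).

Definition AB : comalg K := talg A B.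

(* AB_plus is A ⊗ B^+ itself; AB_incl is its inclusion into A ⊗ B. *)
Definition AB_plus : lmodType K := tens A (submod Bp).

Definition AB_incl : AB_plus -> AB :=
  tlift (fun (a : A) (b : submod Bp) => (a ⊗ submod_val b : tens A B)).

Definition AB_act (a : A) : AB_plus -> AB_plus :=
  tlift (fun (a' : A) (b : submod Bp) => (a * a' : A) ⊗ b).

Definition AB_A (a : A) : AB := a ⊗ (1 : B).

Definition letters : lmodType K := tens (freemod K Omega) AB_plus.

Definition FMRBA : lmodType K := @dsum K nat (fun k => tens AB (tpow letters k)).

Fixpoint word (s : seq (Omega * AB_plus)) : tpow letters (size s) :=
  if s is (w, u) :: s' then (fbasis K w ⊗ u) ⊗ word s' else (1 : K).

(* u0 ⊗ (w_1 ⊗ u_1) ⊗ ... ⊗ (w_n ⊗ u_n), with n = size s; in degree 0, AB is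
   represented as AB ⊗ K. *)
Definition pure (u0 : AB) (s : seq (Omega * AB_plus)) : FMRBA :=
  @dinj K nat (fun k => tens AB (tpow letters k)) (size s) (u0 ⊗ word s).

(* u x, where u : AB multiplies the first tensor factor of x. *)
Definition FMRBA_scale (u : AB) (x : FMRBA) : FMRBA :=
  @dlift K nat (fun k => tens AB (tpow letters k)) FMRBA
    (fun k => tlift (fun (v : AB) (t : tpow letters k) =>
       @dinj K nat (fun k => tens AB (tpow letters k)) k ((u * v : AB) ⊗ t))) x.

Definition phi (w : Omega) (a : A) : A :=
  mt_tauV A w * mt_op w (mt_tau A w * a).

(* is_PF and is_mulF prescribe a linear map and a bilinear map on pure tensors;
   since these span FMRBA, each determines its map uniquely. *)
Record is_PF (PF : Omega -> FMRBA -> FMRBA) : Prop := IsPF {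
  PF_linear : forall w, linear (PF w);
  PF_A0 : forall w (a : A), PF w (pure (AB_A a) [::]) = pure (AB_A (phi w a)) [::];
  PF_A : forall w (a : A) w1 u1 s,
    PF w (pure (AB_A a) ((w1, u1) :: s)) =
      pure (AB_A (phi w a)) ((w1, u1) :: s)
      - pure 1 ((w1, AB_act (phi w a) u1) :: s);
  PF_plus : forall w (u : AB_plus) s,
    PF w (pure (AB_incl u) s) = pure 1 ((w, u) :: s)
}.

Record is_mulF (PF : Omega -> FMRBA -> FMRBA) (mul : FMRBA -> FMRBA -> FMRBA) :
    Prop := IsMulF {
  mulF_bilinear : bilinear_map mul;
  mulF_00 : forall u0 v0, mul (pure u0 [::]) (pure v0 [::]) = pure (u0 * v0) [::];
  mulF_0S : forall u0 v0 y t,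
    mul (pure u0 [::]) (pure v0 (y :: t)) = pure (u0 * v0) (y :: t);
  mulF_S0 : forall u0 x s v0,
    mul (pure u0 (x :: s)) (pure v0 [::]) = pure (u0 * v0) (x :: s);
  mulF_SS : forall u0 w1 u1 s v0 e1 v1 t,
    mul (pure u0 ((w1, u1) :: s)) (pure v0 ((e1, v1) :: t)) =
      FMRBA_scale (u0 * v0)
        (PF e1 (mul (PF w1 (pure (AB_incl u1) s)) (pure (AB_incl v1) t)))
      + FMRBA_scale (u0 * v0)
        (PF w1 (mul (pure (AB_incl u1) s) (PF e1 (pure (AB_incl v1) t))))
}.

Definition jF (a : A) : FMRBA := pure (AB_A a) [::].

Definition iF (b : B) : FMRBA := pure ((1 : A) ⊗ b) [::].

Definition oneF : FMRBA := pure 1 [::].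

Definition PFtau (PF : Omega -> FMRBA -> FMRBA) (mul : FMRBA -> FMRBA -> FMRBA)
    (w : Omega) (x : FMRBA) : FMRBA :=
  mul (jF (mt_tau A w)) (PF w (mul (jF (mt_tauV A w)) x)).

Lemma AB_AM (a b : A) : AB_A a * AB_A b = AB_A (a * b).
Proof. by rewrite /AB_A [LHS]tens_mulE mulr1. Qed.

Lemma AB_AM1 (a : A) : AB_A a * 1 = AB_A a.
Proof. exact: mulr1. Qed.

Lemma FMRBA_scale_pure u v s : FMRBA_scale u (pure v s) = pure (u * v) s.
Proof.
have bil k : bilinear_map (fun (v : AB) (t : tpow letters k) =>
    @dinj K nat (fun k => tens AB (tpow letters k)) k ((u * v : AB) ⊗ t)).
  split=> [t c x y|x c t t']; rewrite -linearP; congr dinj.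
    by rewrite mulrDr -calg_scalerAr tpairDl tpairZl.
  by rewrite tpairDr tpairZr.
rewrite /FMRBA_scale /pure dlift_dinj ?(tliftE (bil _)) // => k.
exact: (tlift_linear (bil k)).
Qed.

Lemma AB_act_bil (a : A) :
  bilinear_map (fun (a' : A) (b : submod Bp) => (a * a' : A) ⊗ b).
Proof.
split=> [b c x y|x c b b']; last by rewrite tpairDr tpairZr.
by rewrite mulrDr -calg_scalerAr tpairDl tpairZl.
Qed.

Lemma AB_incl_bil :
  bilinear_map (fun (a : A) (b : submod Bp) => (a ⊗ submod_val b : tens A B)).
Proof.
split=> [b c x y|x c b b']; first by rewrite tpairDl tpairZl.
by rewrite -[submod_val _]/(c *: submod_val b + submod_val b') tpairDr tpairZr.
Qed.

Lemma AB_inclM (a : A) (u : AB_plus) : AB_A a * AB_incl u = AB_incl (AB_act a u).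
Proof.
have iL : linear AB_incl by exact: (tlift_linear AB_incl_bil).
have aL : linear (AB_act a) by exact: (tlift_linear (AB_act_bil a)).
have iE x y : AB_incl (x ⊗ y) = x ⊗ submod_val y by exact: (tliftE AB_incl_bil).
have aE x y : AB_act a (x ⊗ y) = (a * x : A) ⊗ y by exact: (tliftE (AB_act_bil a)).
elim/tens_ind: u => [|a' b u IH].
  by rewrite (lin0 aL) (lin0 iL); exact: mulr0.
rewrite (linD aL) !(linD iL) -IH aE !iE [LHS](mulrDr (AB_A a)); congr (_ + _).
by rewrite [LHS]tens_mulE mul1r.
Qed.

(* The explicit formulas for the twisted operators. *)
Lemma PFtau_A0 PF mul : is_PF PF -> is_mulF PF mul -> forall w (a : A),
  PFtau PF mul w (jF a) = jF (mt_op w a).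
Proof.
move=> hP hm w a; rewrite /PFtau (mulF_00 hm) AB_AM (PF_A0 hP) (mulF_00 hm) AB_AM.
by rewrite /phi !mulrA (mtrba_tauV (mtrbaP A)) !mul1r.
Qed.

Lemma PFtau_A PF mul : is_PF PF -> is_mulF PF mul -> forall w (a : A) w1 u1 s,
  PFtau PF mul w (pure (AB_A a) ((w1, u1) :: s)) =
    pure (AB_A (mt_op w a)) ((w1, u1) :: s)
    - pure (AB_A (mt_tau A w)) ((w1, AB_act (mt_tauV A w * mt_op w a) u1) :: s).
Proof.
move=> hP hm w a w1 u1 s.
have tK x : mt_tau A w * (mt_tauV A w * x) = x.
  by rewrite mulrA (mtrba_tauV (mtrbaP A)) mul1r.
rewrite /PFtau (mulF_0S hm) AB_AM (PF_A hP) /phi tK.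
rewrite (linD ((mulF_bilinear hm).2 _)) (linN ((mulF_bilinear hm).2 _)).
by rewrite !(mulF_0S hm) AB_AM tK AB_AM1.
Qed.

Lemma PFtau_plus PF mul : is_PF PF -> is_mulF PF mul ->
  forall w (u : AB_plus) s,
  PFtau PF mul w (pure (AB_incl u) s) =
    pure (AB_A (mt_tau A w)) ((w, AB_act (mt_tauV A w) u) :: s).
Proof.
move=> hP hm w u s; rewrite /PFtau.
have -> : mul (jF (mt_tauV A w)) (pure (AB_incl u) s) =
          pure (AB_incl (AB_act (mt_tauV A w) u)) s.
  by rewrite -AB_inclM; case: s => [|y t]; rewrite ?(mulF_00 hm) ?(mulF_0S hm).
by rewrite (PF_plus hP) (mulF_0S hm) AB_AM1.
Qed.

End FreeConstruction.

(* Main.v *)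
Require Import Defs.
From HB Require Import structures.
From mathcomp Require Import all_boot all_algebra.
From mathcomp Require Import boolp.

Set Implicit Arguments.
Unset Strict Implicit.
Unset Printing Implicit Defensive.

Import GRing.Theory.
Local Open Scope ring_scope.

(** Write X for A ⊗ B, P_w for the operators PF w, ⊛ for the product, and let X
act on F = FMRBA A Bp through the first tensor factor (u • x).  The tensors
whose head lies in A ⊗ B^+ are called plus tensors here.

The twist can be conjugated away: operators rho_w satisfy the twisted
identity with twists tau_w exactly when the phi_w = tau_w^-1 rho_w tau_w satisfy
the plain matching Rota-Baxter identity
  P_v x P_w y = P_w (P_v x y) + P_v (x P_w y)                             (RB)
([phi_RB]).  So everything is done with phi on A and on the target algebras, and
with P on F; the twist comes back only when the twisted operators of F are
compared with P.

The operators and the product exist because the prescriptions on pure tensors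
are multilinear.  For P this uses the splitting X = A ⊕ A ⊗ B^+ given by the
augmentation of B; the product is X-bilinear, and on words it is a shuffle,
defined by recursion on both lengths ([shuffle]).

The defining clauses then say three things, for a in A and x, y plus tensors:
P_w extends phi_w; P_w (a • P_v x) = phi_w(a) • P_v x - P_v (phi_w(a) • x); and
(RB) holds for x and y.  The second is (RB) for the pair a, x, and it
propagates to all x ([PF_parts]).  With it (RB) propagates from plus tensors to
all of F, one argument at a time, because F is spanned by A, the a • P_v x and
the plus tensors ([mulF_plus_RB], [mulF_RB_left], [mulF_RB]).

As an X-module F is generated from 1 by the P_w on plus tensors
([FMRBA_ind_word]).  Commutativity and associativity are X-linear in each
argument, so it is enough to check them on 1 and on values of P, where (RB)
expresses both sides by products of smaller elements.  In the same way a
morphism g out of F is determined by its restriction to X, which is jR ⊗ f, and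
by g (P_w x) = phi_w (g x) on plus tensors; these two rules define it
([free_hom]), and the same inductions show that it commutes with P and ⊛. *)

Local Notation "u • x" := (FMRBA_scale u x) (at level 40, left associativity).

(** * Linear maps out of direct sums, tensor products and free modules *)

Lemma dsum_ind (K : pzRingType) (I : choiceType) (V : I -> lmodType K)
    (P : dsum V -> Prop) :
  P 0 -> (forall x y, P x -> P y -> P (x + y)) ->
  (forall i (v : V i), P (dinj v)) -> forall x, P x.
Proof.
move=> P0 PD Pi x.
have -> : x = \sum_(i <- dsupp x) dinj (x i).
  apply: dsum_eq => j.
  have ev_sum (s : seq I) (G : I -> dsum V) :
      (\sum_(i <- s) G i) j = \sum_(i <- s) G i j.
    by elim: s => [|i s IH]; rewrite ?big_nil // !big_cons -IH.
  rewrite ev_sum; case: (boolP (j \in dsupp x)) => jx.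
    rewrite (bigD1_seq j jx (dsupp_uniq x)) dinj_in big1 => [|i ij].
      by rewrite /= addr0.
    exact: dinj_out.
  rewrite (dsuppP jx) big_seq big1 // => i ix; rewrite dinj_out //.
  by apply: contraNneq jx => <-.
by elim: (dsupp x) => [|i s IH]; rewrite ?big_nil // big_cons; apply: PD.
Qed.

Section LinearMaps.
Variable K : fieldType.
Implicit Types U V W Z : lmodType K.

Lemma linear_comp U V W (f : V -> W) (g : U -> V) :
  linear f -> linear g -> linear (fun x => f (g x)).
Proof. by move=> fl gl c x y; rewrite gl fl. Qed.

Lemma linear_add U V (f g : U -> V) :
  linear f -> linear g -> linear (fun x => f x + g x).
Proof. by move=> fl gl c x y; rewrite fl gl scalerDr addrACA. Qed.

Lemma linear_opp U V (f : U -> V) : linear f -> linear (fun x => - f x).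
Proof. by move=> fl c x y; rewrite fl opprD scalerN. Qed.

(** Constructions by nested lifts need a lift to depend linearly on any
parameter that its bilinear map depends on linearly. *)
Lemma tlift_param Z V W U (f : Z -> V -> W -> U) (t : tens V W) :
  (forall z, bilinear_map (f z)) -> (forall v w, linear (fun z => f z v w)) ->
  linear (fun z => tlift (f z) t).
Proof.
move=> fb fl c x y.
suff /(_ t) : tlift (f (c *: x + y)) =1
    (fun t => c *: tlift (f x) t + tlift (f y) t) by [].
apply: tens_ext => [d s s'|d s s'|v w]; last by rewrite !(tliftE (fb _)) fl.
  exact: (tlift_linear (fb _)).
rewrite !(tlift_linear (fb _)) !scalerDr !scalerA (mulrC c d).
by rewrite addrACA.
Qed.

End LinearMaps.

Section FreemodLift.
Variables (K : fieldType) (I : choiceType).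

Definition fmlift (U : lmodType K) (G : I -> U) (x : freemod K I) : U :=
  @dlift K I (fun=> regmod K) U (fun i (c : K) => c *: G i) x.

Lemma fmlift_linear (U : lmodType K) (G : I -> U) : linear (fmlift G).
Proof. by apply: dlift_linear => i c x y; rewrite scalerDl scalerA. Qed.

Lemma fmlift_basis (U : lmodType K) (G : I -> U) i : fmlift G (fbasis K i) = G i.
Proof.
rewrite /fmlift /fbasis dlift_dinj ?scale1r // => j c x y.
by rewrite scalerDl scalerA.
Qed.

Lemma fmlift_param (Z U : lmodType K) (G : Z -> I -> U) o :
  (forall i, linear (G^~ i)) -> linear (fun z => fmlift (G z) o).
Proof.
move=> Gl; elim/freemod_ind: o => [|c i o IH] d x y.
  by rewrite !(lin0 (fmlift_linear _)) scaler0 addr0.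
rewrite !(fmlift_linear _ c) IH !fmlift_basis Gl.
by rewrite !scalerDr !scalerA mulrC addrACA.
Qed.

End FreemodLift.

(** * Pure tensors and the module of words *)

Section TensorPowers.
Variables (K : fieldType) (Omega : choiceType) (A : mtrba K Omega).
Variables (B : comalg K) (Bp : submodClosed B).

Local Notation F := (FMRBA A Bp).
Local Notation L := (letters A Bp).
Local Notation X := (AB A B).

(** The predicate ranges over all exponents at once because word s lives in the
power of exponent size s: with a fixed exponent the last hypothesis would need a
transport along size s = k. *)
Lemma tpow_ind (Q : forall k, tpow L k -> Prop) :
  (forall k, Q k 0) -> (forall k x y, Q k x -> Q k y -> Q k (x + y)) ->
  (forall k (c : K) x, Q k x -> Q k (c *: x)) ->
  (forall s : seq (Omega * AB_plus A Bp), Q (size s) (word s)) ->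
  forall k t, Q k t.
Proof.
move=> Q0 QD QZ Qw k; elim: k Q Q0 QD QZ Qw => [|k IH] Q Q0 QD QZ Qw t.
  have -> : t = (t : K) *: (word [::] : tpow L 0).
    by rewrite -[RHS]/((t : K) * 1) mulr1.
  exact/QZ/(Qw [::]).
have QP w v (t' : tpow L k) : Q k.+1 ((fbasis K w ⊗ v) ⊗ t' : tens L (tpow L k)).
  apply: (IH (fun k t => Q k.+1 ((fbasis K w ⊗ v) ⊗ t : tens L (tpow L k)))).
  - by move=> j; rewrite (lin0 ((tpair_bilinear _ _).2 _)); exact: Q0.
  - by move=> j x y Qx Qy; rewrite tpairDr; exact: QD.
  - by move=> j c x Qx; rewrite tpairZr; exact: QZ.
  by move=> s; exact: (Qw ((w, v) :: s)).
elim/tens_ind: t => [|p t' t Qt]; first exact: Q0.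
apply: (QD) => // {Qt}.
elim/tens_ind: p => [|o v p Qp].
  by rewrite (lin0 ((tpair_bilinear _ _).1 _)); exact: Q0.
rewrite tpairDl; apply: (QD) => // {Qp}.
elim/freemod_ind: o => [|c w o Qo].
  rewrite [X in X ⊗ _](lin0 ((tpair_bilinear _ _).1 _)).
  by rewrite (lin0 ((tpair_bilinear _ _).1 _)); exact: Q0.
rewrite tpairDl tpairDl tpairZl tpairZl.
by apply: (QD) => //; apply: QZ; exact: QP.
Qed.

Lemma pure_linear s : linear (fun u : X => pure u s : F).
Proof. by move=> c u v; rewrite /pure -linearP tpairDl tpairZl. Qed.

Lemma FMRBA_ind_pure (P : F -> Prop) :
  P 0 -> (forall x y, P x -> P y -> P (x + y)) ->
  (forall u s, P (pure u s)) -> forall x, P x.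
Proof.
move=> P0 PD Pp; apply: dsum_ind => // k.
elim/tens_ind => [|u t v Pv]; first by rewrite linear0.
rewrite linearD; apply: (PD) => // {v Pv}; elim/tpow_ind: t u => {k}.
- by move=> k u; rewrite (lin0 ((tpair_bilinear _ _).2 _)) linear0.
- by move=> k x y Px Py u; rewrite tpairDr linearD; exact: PD.
- by move=> k c x Px u; rewrite tpairZr -tpairZl.
by move=> s u; exact: Pp.
Qed.

Lemma FMRBA_ext (U : lmodType K) (f g : F -> U) : linear f -> linear g ->
  (forall u s, f (pure u s) = g (pure u s)) -> f =1 g.
Proof.
move=> fl gl fg; apply: FMRBA_ind_pure => //; first by rewrite !lin0.
by move=> x y fx fy; rewrite !linD // fx fy.
Qed.

Definition Flift (U : lmodType K) (H : forall k, X -> tpow L k -> U) : F -> U :=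
  @dlift K nat (fun k => tens X (tpow L k)) U (fun k => tlift (H k)).

Section FliftTheory.
Variables (U : lmodType K) (H : forall k, X -> tpow L k -> U).
Hypothesis Hb : forall k, bilinear_map (@H k).

Lemma Flift_linear : linear (Flift H).
Proof. by apply: dlift_linear => k; exact: tlift_linear. Qed.

Lemma Flift_pure u s : Flift H (pure u s) = H u (word s).
Proof.
rewrite /Flift /pure dlift_dinj ?tliftE // => k; exact: tlift_linear.
Qed.

End FliftTheory.

Lemma Flift_param (Z U : lmodType K) (H : Z -> forall k, X -> tpow L k -> U) y :
  (forall z k, bilinear_map (H z k)) -> (forall k u t, linear (fun z => H z k u t)) ->
  linear (fun z => Flift (H z) y).
Proof.
move=> Hb Hl c a b.
elim/FMRBA_ind_pure: y => [|x y IHx IHy|u s].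
- by rewrite !(lin0 (Flift_linear (Hb _))) scaler0 addr0.
- by rewrite !(linD (Flift_linear (Hb _))) IHx IHy scalerDr addrACA.
by rewrite !(Flift_pure (Hb _)) Hl.
Qed.

Lemma dinj_pair_bil k : bilinear_map (fun (u : X) (t : tpow L k) =>
  @dinj K nat (fun k => tens X (tpow L k)) k (u ⊗ t) : F).
Proof.
by split=> [t c u v|u c t t']; rewrite -linearP ?tpairDl ?tpairZl ?tpairDr ?tpairZr.
Qed.

End TensorPowers.

Section LetterLift.
Variables (K : fieldType) (Omega : choiceType) (A : mtrba K Omega).
Variables (B : comalg K) (Bp : submodClosed B).

Local Notation L := (letters A Bp).

Variables (U : lmodType K) (E : Omega -> AB_plus A Bp -> U -> U).
Hypothesis Eb : forall w, bilinear_map (E w).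

(** The action on U of a letter, extended linearly from the basis of the first
factor.  It is used with U = F, for the product, and with U a matching
Rota-Baxter algebra, for the morphism out of F. *)
Definition letter_lift (p : L) (r : U) : U :=
  tlift (fun o (u : AB_plus A Bp) => fmlift (fun w => E w u r) o) p.

Lemma letter_lift_bil0 r :
  bilinear_map (fun o (u : AB_plus A Bp) => fmlift (fun w => E w u r) o).
Proof.
split=> [u|o]; first exact: fmlift_linear.
by apply: fmlift_param => w; exact: (Eb w).1.
Qed.

Lemma letter_lift_bil : bilinear_map letter_lift.
Proof.
split=> [r|p]; first exact: (tlift_linear (letter_lift_bil0 r)).
apply: tlift_param => [r|o u]; first exact: letter_lift_bil0.
by apply: fmlift_param => w; exact: (Eb w).2.
Qed.

Lemma letter_liftE w u r : letter_lift (fbasis K w ⊗ u) r = E w u r.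
Proof. by rewrite /letter_lift (tliftE (letter_lift_bil0 r)) fmlift_basis. Qed.

End LetterLift.

(** * The action of A ⊗ B on the first tensor factor *)

Section ScaleTheory.
Variables (K : fieldType) (Omega : choiceType) (A : mtrba K Omega).
Variables (B : comalg K) (Bp : submodClosed B).

Local Notation F := (FMRBA A Bp).
Local Notation L := (letters A Bp).
Local Notation X := (AB A B).

Lemma FMRBA_scale_bil u k : bilinear_map (fun (v : X) (t : tpow L k) =>
  @dinj K nat (fun k => tens X (tpow L k)) k ((u * v : X) ⊗ t) : F).
Proof.
split=> [t c x y|x c t t']; rewrite -linearP; congr dinj.
  by rewrite mulrDr -calg_scalerAr tpairDl tpairZl.
by rewrite tpairDr tpairZr.
Qed.

Lemma FMRBA_scale_linear u : linear (FMRBA_scale u : F -> F).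
Proof. exact: (Flift_linear (FMRBA_scale_bil u)). Qed.

Lemma FMRBA_scaleA u v (x : F) : u • (v • x) = (u * v) • x.
Proof.
move: x; apply: FMRBA_ext => [||w s]; last by rewrite !FMRBA_scale_pure mulrA.
  exact: linear_comp (FMRBA_scale_linear _) (FMRBA_scale_linear _).
exact: FMRBA_scale_linear.
Qed.

Lemma FMRBA_scale1 (x : F) : (1 : X) • x = x.
Proof.
move: x; apply: FMRBA_ext => [||w s]; last by rewrite FMRBA_scale_pure mul1r.
  exact: FMRBA_scale_linear.
by [].
Qed.

Lemma FMRBA_scaleDr u (x y : F) : u • (x + y) = u • x + u • y.
Proof. exact: (linD (FMRBA_scale_linear u)). Qed.

Lemma FMRBA_scaleNr u (x : F) : u • (- x) = - (u • x).
Proof. exact: (linN (FMRBA_scale_linear u)). Qed.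

Lemma FMRBA_scaleDl u v (x : F) : (u + v) • x = u • x + v • x.
Proof.
move: x; apply: FMRBA_ext => [||w s].
- exact: FMRBA_scale_linear.
- exact: linear_add (FMRBA_scale_linear _) (FMRBA_scale_linear _).
by rewrite !FMRBA_scale_pure mulrDl (linD (pure_linear s)).
Qed.

Lemma FMRBA_scale_param (x : F) : linear (fun u => FMRBA_scale u x : F).
Proof.
elim/FMRBA_ind_pure: x => [|x y IHx IHy|v s] c u u'.
- by rewrite !(lin0 (FMRBA_scale_linear _)) scaler0 addr0.
- by rewrite !FMRBA_scaleDr IHx IHy scalerDr addrACA.
by rewrite !FMRBA_scale_pure mulrDl -calg_scalerAl pure_linear.
Qed.

Lemma FMRBA_scale_oneF u : u • oneF A Bp = pure u [::].
Proof. by rewrite FMRBA_scale_pure mulr1. Qed.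

End ScaleTheory.

(** * The splitting of A ⊗ B given by the augmentation *)

Section SubmodClosed.
Variables (K : pzRingType) (V : lmodType K) (S : submodClosed V).

Lemma submod0 : 0 \in S.
Proof. exact: rpred0. Qed.

Lemma submodZD (c : K) x y : x \in S -> y \in S -> c *: x + y \in S.
Proof. by move=> xS yS; apply: rpredD => //; apply: rpredZ. Qed.

Lemma submodB x y : x \in S -> y \in S -> x - y \in S.
Proof. by move=> xS yS; rewrite -scaleN1r addrC; exact: submodZD. Qed.

End SubmodClosed.

Section Splitting.
Variables (K : fieldType) (Omega : choiceType) (A : mtrba K Omega).
Variables (B : comalg K) (Bp : submodClosed B).
Hypothesis augB : augmentation Bp.

Local Notation X := (AB A B).

(** The augmentation B -> K: the component of b on the summand K. *)
Definition aug_eps (b : B) : K := projT1 (cid (aug_sum augB b)).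

Lemma aug_epsP b : b - aug_eps b *: (1 : B) \in Bp.
Proof.
rewrite /aug_eps; case: cid => c /= [b' b'P {1}->].
by rewrite addrC addKr.
Qed.

Lemma aug_eps_unique (c : K) b : b - c *: (1 : B) \in Bp -> aug_eps b = c.
Proof.
move=> bc; apply/eqP; rewrite -subr_eq0; apply/eqP/(aug_cap augB).
have -> : (aug_eps b - c) *: (1 : B) =
    (b - c *: (1 : B)) - (b - aug_eps b *: (1 : B)).
  by rewrite scalerBl opprB [RHS]addrC addrA subrK.
by apply: (submodB (V := B)) => //; exact: aug_epsP.
Qed.

Lemma aug_eps_linear : linear (aug_eps : B -> regmod K).
Proof.
move=> c x y; apply: aug_eps_unique.
have -> : c *: x + y - (c * aug_eps x + aug_eps y) *: (1 : B) =
   c *: (x - aug_eps x *: (1 : B)) + (y - aug_eps y *: (1 : B)).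
  by rewrite scalerDl opprD addrACA scalerBr scalerA.
by apply: (submodZD (V := B)); exact: aug_epsP.
Qed.

Lemma aug_eps1 : aug_eps 1 = 1.
Proof. by apply: aug_eps_unique; rewrite scale1r subrr; exact: (submod0 (V := B)). Qed.

Lemma aug_eps_plus b : b \in Bp -> aug_eps b = 0.
Proof. by move=> bP; apply: aug_eps_unique; rewrite scale0r subr0. Qed.

Definition aug_proj (b : B) : submod Bp := Submod (aug_epsP b).

Lemma aug_proj_linear : linear aug_proj.
Proof.
move=> c x y; apply: val_inj => /=.
rewrite -[RHS]/(c *: (x - aug_eps x *: (1 : B)) + (y - aug_eps y *: (1 : B))).
rewrite aug_eps_linear -[_ *: (aug_eps x : regmod K)]/(c * aug_eps x).
by rewrite scalerDl opprD addrACA scalerBr scalerA.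
Qed.

Lemma aug_proj1 : aug_proj 1 = 0.
Proof. by apply: val_inj; rewrite /= aug_eps1 scale1r subrr. Qed.

Lemma aug_proj_plus (b : submod Bp) : aug_proj (submod_val b) = b.
Proof.
by apply: val_inj; case: b => b bP /=; rewrite aug_eps_plus // scale0r subr0.
Qed.

Definition AB_projA : X -> A :=
  tlift (fun (a : A) (b : B) => (aug_eps b *: a : A)).

Definition AB_projP : X -> AB_plus A Bp :=
  tlift (fun (a : A) (b : B) => (a ⊗ aug_proj b : tens A (submod Bp))).

Lemma AB_projA_bil : bilinear_map (fun (a : A) (b : B) => (aug_eps b *: a : A)).
Proof.
split=> [b c x y|a c x y]; first by rewrite scalerDr !scalerA mulrC.
by rewrite aug_eps_linear scalerDl -scalerA.
Qed.

Lemma AB_projP_bil :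
  bilinear_map (fun (a : A) (b : B) => (a ⊗ aug_proj b : tens A (submod Bp))).
Proof.
split=> [b c x y|a c x y]; first by rewrite tpairDl tpairZl.
by rewrite aug_proj_linear tpairDr tpairZr.
Qed.

Lemma AB_projA_linear : linear AB_projA.
Proof. exact: (tlift_linear AB_projA_bil). Qed.

Lemma AB_projP_linear : linear AB_projP.
Proof. exact: (tlift_linear AB_projP_bil). Qed.

Lemma AB_incl_linear : linear (@AB_incl K Omega A B Bp).
Proof. exact: (tlift_linear (AB_incl_bil A Bp)). Qed.

Lemma AB_inclE (a : A) (b : submod Bp) :
  AB_incl (a ⊗ b : AB_plus A Bp) = a ⊗ submod_val b.
Proof. exact: (tliftE (AB_incl_bil A Bp)). Qed.

Lemma AB_act_linear a : linear (@AB_act K Omega A B Bp a).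
Proof. exact: (tlift_linear (AB_act_bil Bp a)). Qed.

Lemma AB_A_linear : linear (@AB_A K Omega A B).
Proof. by move=> c x y; rewrite /AB_A tpairDl tpairZl. Qed.

(** A ⊗ B is spanned by A and A ⊗ B^+; that the sum is direct follows from the four
values of the projections below. *)
Lemma AB_split (u : X) : u = AB_A B (AB_projA u) + AB_incl (AB_projP u).
Proof.
suff : id =1 (fun u : X => AB_A B (AB_projA u) + AB_incl (AB_projP u)) by apply.
apply: (@tens_ext K A B X) => {u}.
- by [].
- apply: linear_add.
    exact: linear_comp AB_A_linear AB_projA_linear.
  exact: linear_comp AB_incl_linear AB_projP_linear.
move=> a b; rewrite /AB_projA (tliftE AB_projA_bil) /AB_projP (tliftE AB_projP_bil).
rewrite AB_inclE /AB_A tpairZl -tpairZr -[LHS]/(a ⊗ b : tens A B).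
rewrite -[RHS]/(a ⊗ (aug_eps b *: (1 : B)) + a ⊗ (b - aug_eps b *: (1 : B)) : tens A B).
by rewrite -tpairDr addrC subrK.
Qed.

Lemma AB_projA_A a : AB_projA (AB_A B a) = a.
Proof. by rewrite /AB_projA (tliftE AB_projA_bil) aug_eps1 scale1r. Qed.

Lemma AB_projP_A a : AB_projP (AB_A B a) = 0.
Proof.
rewrite /AB_projP (tliftE AB_projP_bil) aug_proj1.
exact: (lin0 ((tpair_bilinear _ _).2 _)).
Qed.

Lemma AB_projA_incl (u : AB_plus A Bp) : AB_projA (AB_incl u) = 0.
Proof.
move: u; apply: (tens_ext (g := fun=> 0)).
- exact: linear_comp AB_projA_linear AB_incl_linear.
- by move=> c x y; rewrite scaler0 addr0.
move=> a b; rewrite AB_inclE /AB_projA (tliftE AB_projA_bil).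
by rewrite aug_eps_plus ?scale0r //; case: b.
Qed.

Lemma AB_projP_incl (u : AB_plus A Bp) : AB_projP (AB_incl u) = u.
Proof.
move: u; apply: (tens_ext (g := id)).
- exact: linear_comp AB_projP_linear AB_incl_linear.
- by [].
by move=> a b; rewrite AB_inclE /AB_projP (tliftE AB_projP_bil) aug_proj_plus.
Qed.

End Splitting.

(** * Removing the twist *)

Lemma phi_linear (K : fieldType) (Omega : choiceType) (S : mtrba K Omega) w :
  linear (@phi K Omega S w).
Proof.
move=> c x y; rewrite /phi mulrDr -calg_scalerAr (mtrba_linear (mtrbaP S)).
by rewrite mulrDr -calg_scalerAr.
Qed.

(** In the twisted identity for tau_w a and tau_v b, multiplication by
tau_w^-1 tau_v^-1 cancels the twist in every term. *)
Lemma phi_RB (K : fieldType) (Omega : choiceType) (A : mtrba K Omega)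
    (w v : Omega) (a b : A) :
  phi w a * phi v b = phi v (phi w a * b) + phi w (a * phi v b).
Proof.
have V u : mt_tauV A u * mt_tau A u = 1 by rewrite mulrC (mtrba_tauV (mtrbaP A)).
rewrite /phi mulrACA (mtrba_eq (mtrbaP A)) mulrDr; congr (_ + _).
  by rewrite mulrACA V mul1r mulrCA.
rewrite [_ * mt_tauV A v]mulrC mulrACA V mul1r; congr (_ * mt_op _ _).
by rewrite -mulrA [RHS]mulrA [RHS]mulrCA.
Qed.

(** * Existence of the operators *)

Section ExistencePF.
Variables (K : fieldType) (Omega : choiceType) (A : mtrba K Omega).
Variables (B : comalg K) (Bp : submodClosed B).
Hypothesis augB : augmentation Bp.

Local Notation F := (FMRBA A Bp).
Local Notation L := (letters A Bp).
Local Notation X := (AB A B).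
Local Notation din k v :=
  (@dinj K nat (fun n => tens X (tpow L n)) k v : F).

Definition letter_act (a : A) : L -> L :=
  tlift (fun (o : freemod K Omega) (u : AB_plus A Bp) => (o ⊗ AB_act a u : L)).

Lemma letter_act_bil a : bilinear_map
  (fun (o : freemod K Omega) (u : AB_plus A Bp) => (o ⊗ AB_act a u : L)).
Proof.
split=> [u c x y|o c x y]; first by rewrite tpairDl tpairZl.
by rewrite AB_act_linear tpairDr tpairZr.
Qed.

Lemma AB_act_param (u : AB_plus A Bp) : linear (fun a : A => AB_act a u).
Proof.
apply: tlift_param => [a|a' b]; first exact: AB_act_bil.
by move=> c x y; rewrite mulrDl -calg_scalerAl tpairDl tpairZl.
Qed.

Lemma letter_act_linear a : linear (letter_act a).
Proof. exact: (tlift_linear (letter_act_bil a)). Qed.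

Lemma letter_actE a o (u : AB_plus A Bp) :
  letter_act a (o ⊗ u) = o ⊗ AB_act a u.
Proof. exact: (tliftE (letter_act_bil a)). Qed.

Lemma letter_act_param p : linear (fun a => letter_act a p).
Proof.
apply: tlift_param => [a|o u]; first exact: letter_act_bil.
by move=> c x y; rewrite AB_act_param tpairDr tpairZr.
Qed.

(** PF_corr a is the term subtracted in the clause of P_w for heads in A,
1 ⊗ (w_1 ⊗ a u_1) ⊗ ...; there is none in degree 0. *)
Definition PF_corrS j (a : A) (p : L) (t : tpow L j) : F :=
  din j.+1 ((1 : X) ⊗ (letter_act a p ⊗ t : tpow L j.+1)).

Definition PF_corr k (a : A) : tpow L k -> F :=
  match k return tpow L k -> F with
  | 0 => fun _ => 0
  | j.+1 => tlift (@PF_corrS j a)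
  end.

Lemma PF_corrS_bil j a : bilinear_map (@PF_corrS j a).
Proof.
have dl := (dinj_pair_bil A Bp j.+1).2 (1 : X).
split=> [t|p]; apply: (linear_comp dl).
  apply: (linear_comp ((tpair_bilinear L (tpow L j)).1 t)).
  exact: letter_act_linear.
exact: (tpair_bilinear L (tpow L j)).2.
Qed.

Lemma PF_corr_bil k : bilinear_map (@PF_corr k).
Proof.
case: k => [|j]; first by split=> [t|a] c x y; rewrite /= scaler0 addr0.
split=> [t|a]; last exact: (tlift_linear (PF_corrS_bil j a)).
apply: tlift_param => [a|p t']; first exact: PF_corrS_bil.
have dl := (dinj_pair_bil A Bp j.+1).2 (1 : X).
apply: (linear_comp dl).
apply: (linear_comp ((tpair_bilinear L (tpow L j)).1 t')).
exact: letter_act_param.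
Qed.

(** The first two terms are the clauses for the A-component of u, the last one
the clause for its component in A ⊗ B^+. *)
Definition PF_word w k (u : X) (t : tpow L k) : F :=
  let a := phi w (AB_projA augB u) in
  din k (AB_A B a ⊗ t) - PF_corr a t +
  din k.+1 ((1 : X) ⊗ ((fbasis K w ⊗ (AB_projP augB u : AB_plus A Bp)) ⊗ t : tpow L k.+1)).

Lemma PF_word_bil w k : bilinear_map (@PF_word w k).
Proof.
have al : linear (fun u => phi w (AB_projA (A := A) augB u)).
  exact: linear_comp (@phi_linear K Omega A w) (AB_projA_linear augB).
split=> [t|u]; apply: linear_add; try apply: linear_add; try apply: linear_opp.
- apply: (linear_comp ((dinj_pair_bil A Bp k).1 t)).
  exact: linear_comp (@AB_A_linear _ _ A B) al.
- exact: linear_comp ((PF_corr_bil k).1 t) al.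
- apply: (linear_comp ((dinj_pair_bil A Bp k.+1).2 1)).
  apply: (linear_comp ((tpair_bilinear L (tpow L k)).1 t)).
  apply: (linear_comp ((tpair_bilinear (freemod K Omega) (AB_plus A Bp)).2 _)).
  exact: AB_projP_linear.
- exact: (dinj_pair_bil A Bp k).2.
- exact: (PF_corr_bil k).2.
apply: (linear_comp ((dinj_pair_bil A Bp k.+1).2 1)).
exact: (tpair_bilinear L (tpow L k)).2.
Qed.

Definition PF_map w : F -> F := Flift (PF_word w).

Lemma PF_map_pure w u s : PF_map w (pure u s) = PF_word w u (word s).
Proof. exact: (Flift_pure (PF_word_bil w)). Qed.

Lemma PF_mapP : is_PF PF_map.
Proof.
have pl := @pure_linear K Omega A B Bp.
have phi0 w : phi w (0 : A) = 0 by exact: (lin0 (@phi_linear K Omega A w)).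
split.
- by move=> w; exact: (Flift_linear (PF_word_bil w)).
- move=> w a; rewrite PF_map_pure /PF_word AB_projA_A AB_projP_A /= subr0.
  rewrite (lin0 ((tpair_bilinear _ _).2 _)) (lin0 ((tpair_bilinear _ _).1 _)).
  by rewrite (lin0 ((tpair_bilinear _ _).2 _)) linear0 addr0.
- move=> w a v u s; rewrite PF_map_pure /PF_word AB_projA_A AB_projP_A.
  rewrite (lin0 ((tpair_bilinear _ _).2 _)) (lin0 ((tpair_bilinear _ _).1 _)).
  rewrite (lin0 ((tpair_bilinear _ _).2 _)) linear0 addr0; congr (_ - _).
  by rewrite /= (tliftE (PF_corrS_bil _ _)) /PF_corrS letter_actE.
move=> w u s; rewrite PF_map_pure /PF_word AB_projA_incl AB_projP_incl phi0.
rewrite (lin0 (@AB_A_linear _ _ A B)) (lin0 ((dinj_pair_bil A Bp _).1 _)).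
by rewrite (lin0 ((PF_corr_bil _).1 _)) subr0 add0r.
Qed.

End ExistencePF.

(** * Existence of the product *)

Section ExistenceMul.
Variables (K : fieldType) (Omega : choiceType) (A : mtrba K Omega).
Variables (B : comalg K) (Bp : submodClosed B).

Local Notation F := (FMRBA A Bp).
Local Notation L := (letters A Bp).
Local Notation X := (AB A B).
Local Notation din k v :=
  (@dinj K nat (fun n => tens X (tpow L n)) k v : F).

Variable PF : Omega -> F -> F.
Hypothesis hP : is_PF PF.

(* In a word, the letter w ⊗ u stands for the operator x |-> P_w (u x). *)
Let E w (u : AB_plus A Bp) (x : F) : F := PF w (FMRBA_scale (AB_incl u) x).

Lemma PF_letter_bil w : bilinear_map (E w).
Proof.
split=> [x|u].
  apply: (linear_comp (PF_linear hP w)).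
  exact: linear_comp (FMRBA_scale_param x) (@AB_incl_linear _ _ A B Bp).
exact: linear_comp (PF_linear hP w) (FMRBA_scale_linear _).
Qed.

Local Notation op := (letter_lift E).
Let op_bil : bilinear_map op := letter_lift_bil PF_letter_bil.

(** The product of 1 ⊗ s and 1 ⊗ t.  One step writes 1 ⊗ (p ⊗ s) as p applied to s,
and likewise for the other factor, and expands by the Rota-Baxter identity; it
shortens only one of the two words, hence the inner fixpoint. *)
Fixpoint shuffle m : forall n, tpow L m -> tpow L n -> F :=
  match m return forall n, tpow L m -> tpow L n -> F with
  | 0 => fun n c t => (c : K) *: din n ((1 : X) ⊗ t)
  | i.+1 => fix shuffleS n : tpow L i.+1 -> tpow L n -> F :=
      match n return tpow L i.+1 -> tpow L n -> F with
      | 0 => fun s c => (c : K) *: din i.+1 ((1 : X) ⊗ s)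
      | j.+1 => fun x y =>
          tlift (fun (p : L) (s : tpow L i) =>
            tlift (fun (q : L) (t : tpow L j) =>
              op q (shuffleS j (p ⊗ s) t) + op p (shuffle s (q ⊗ t : tpow L j.+1))) y) x
      end
  end.

Let cross i j (p : L) (s : tpow L i) (q : L) (t : tpow L j) : F :=
  op q (shuffle (p ⊗ s : tpow L i.+1) t) + op p (shuffle s (q ⊗ t : tpow L j.+1)).

Section Step.
Variables i j : nat.
Hypothesis IH1 : bilinear_map (@shuffle i.+1 j).
Hypothesis IH2 : bilinear_map (@shuffle i j.+1).

Lemma cross_bilr p s : bilinear_map (@cross i j p s).
Proof.
split=> [t|q]; apply: linear_add.
- exact: op_bil.1.
- apply: (linear_comp (op_bil.2 p)); apply: (linear_comp (IH2.2 s)).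
  exact: (tpair_bilinear L (tpow L j)).1.
- exact: (linear_comp (op_bil.2 q) (IH1.2 _)).
apply: (linear_comp (op_bil.2 p)); apply: (linear_comp (IH2.2 s)).
exact: (tpair_bilinear L (tpow L j)).2.
Qed.

Lemma cross_bill y : bilinear_map (fun p s => tlift (@cross i j p s) y).
Proof.
split=> [s|p]; (apply: tlift_param => [z|q t]; first exact: cross_bilr);
  apply: linear_add.
- apply: (linear_comp (op_bil.2 q)); apply: (linear_comp (IH1.1 t)).
  exact: (tpair_bilinear L (tpow L i)).1.
- exact: op_bil.1.
- apply: (linear_comp (op_bil.2 q)); apply: (linear_comp (IH1.1 t)).
  exact: (tpair_bilinear L (tpow L i)).2.
exact: (linear_comp (op_bil.2 p) (IH2.1 _)).
Qed.

Lemma shuffleSS_bil : bilinear_map (@shuffle i.+1 j.+1).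
Proof.
split=> [y|x]; first exact: (tlift_linear (cross_bill y)).
apply: tlift_param => [y|p s]; first exact: cross_bill.
exact: (tlift_linear (cross_bilr p s)).
Qed.

Lemma shuffleSS p s q t :
  shuffle (p ⊗ s : tpow L i.+1) (q ⊗ t : tpow L j.+1) = cross p s q t.
Proof.
rewrite -[LHS]/(tlift (fun p s => tlift (@cross i j p s) (q ⊗ t)) (p ⊗ s)).
by rewrite (tliftE (cross_bill _)) (tliftE (cross_bilr _ _)).
Qed.

End Step.

Lemma shuffle_bil m n : bilinear_map (@shuffle m n).
Proof.
elim: m n => [|m IHm] n.
  split=> [t|c] d x y; first by rewrite /= scalerDl scalerA.
  by rewrite /= ((dinj_pair_bil A Bp n).2 1) scalerDr !scalerA mulrC.
elim: n => [|n IHn]; last exact: shuffleSS_bil.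
split=> [t|c] d x y; last by rewrite /= scalerDl scalerA.
by rewrite /= ((dinj_pair_bil A Bp m.+1).2 1) scalerDr !scalerA mulrC.
Qed.

Let prod m n (u : X) (s : tpow L m) (v : X) (t : tpow L n) : F :=
  FMRBA_scale (u * v : X) (shuffle s t).

Definition shuffle_mul (x y : F) : F :=
  Flift (fun m u s => Flift (fun n => @prod m n u s) y) x.

Lemma prod_bilr m n u s : bilinear_map (@prod m n u s).
Proof.
split=> [t|v].
  apply: (linear_comp (FMRBA_scale_param _)) => c x y.
  by rewrite mulrDr -calg_scalerAr.
exact: linear_comp (FMRBA_scale_linear _) ((shuffle_bil m n).2 s).
Qed.

Lemma prod_bill m y : bilinear_map (fun u s => Flift (fun n => @prod m n u s) y).
Proof.
split=> [s|u]; (apply: Flift_param => [z n|n v t]; first exact: prod_bilr).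
  apply: (linear_comp (FMRBA_scale_param _)) => c a b.
  by rewrite mulrDl -calg_scalerAl.
exact: linear_comp (FMRBA_scale_linear _) ((shuffle_bil m n).1 t).
Qed.

Lemma shuffle_mul_pure u s v t :
  shuffle_mul (pure u s) (pure v t) = FMRBA_scale (u * v) (shuffle (word s) (word t)).
Proof.
rewrite /shuffle_mul (Flift_pure (fun m => @prod_bill m _)).
exact: (Flift_pure (fun n => @prod_bilr (size s) n u (word s))).
Qed.

Lemma shuffle_mul_bil : bilinear_map shuffle_mul.
Proof.
split=> [y|x]; first exact: (Flift_linear (fun m => @prod_bill m y)).
apply: Flift_param => [y m|m u s]; first exact: prod_bill.
exact: (Flift_linear (fun n => @prod_bilr m n u s)).
Qed.

Lemma shuffle_mulP : is_mulF PF shuffle_mul.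
Proof.
split; first exact: shuffle_mul_bil.
- by move=> u v; rewrite shuffle_mul_pure /= scale1r FMRBA_scale_oneF.
- move=> u v y t; rewrite shuffle_mul_pure -[y :: t]/([:: y] ++ t) [shuffle _ _]/=.
  by rewrite scale1r -[dinj _]/(pure 1 (y :: t)) FMRBA_scale_pure mulr1.
- move=> u x s v; rewrite shuffle_mul_pure; case: x => w a.
  rewrite [shuffle _ _]/=.
  by rewrite scale1r -[dinj _]/(pure 1 ((w, a) :: s)) FMRBA_scale_pure mulr1.
move=> u w a s v e b t; rewrite shuffle_mul_pure -FMRBA_scaleDr; congr FMRBA_scale.
rewrite [LHS](shuffleSS (shuffle_bil _ _) (shuffle_bil _ _)) /cross.
rewrite !(letter_liftE PF_letter_bil) /E !(PF_plus hP) !shuffle_mul_pure.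
by rewrite mul1r mulr1.
Qed.

End ExistenceMul.

(** * The Rota-Baxter identity and the algebra structure *)

Section Algebra.
Variables (K : fieldType) (Omega : choiceType) (A : mtrba K Omega).
Variables (B : comalg K) (Bp : submodClosed B).
Hypothesis augB : augmentation Bp.

Local Notation F := (FMRBA A Bp).
Local Notation L := (letters A Bp).
Local Notation X := (AB A B).

Variant plus_pure : F -> Prop :=
  PlusPure (u : AB_plus A Bp) s : plus_pure (pure (AB_incl u) s).

Lemma plus_pure_scale (a : A) x : plus_pure x -> plus_pure (AB_A B a • x).
Proof. by case=> u s; rewrite FMRBA_scale_pure AB_inclM. Qed.

Variable PF : Omega -> F -> F.
Hypothesis hP : is_PF PF.

Lemma PF_D w x y : PF w (x + y) = PF w x + PF w y.
Proof. exact: (linD (PF_linear hP w)). Qed.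

Lemma PF_N w x : PF w (- x) = - PF w x.
Proof. exact: (linN (PF_linear hP w)). Qed.

Lemma PF_0 w : PF w 0 = 0.
Proof. exact: (lin0 (PF_linear hP w)). Qed.

(** Suited to predicates that are linear over A ⊗ B, as the word
(w_1 ⊗ u_1) ⊗ ... ⊗ (w_n ⊗ u_n) is P_w1 (u_1 P_w2 (u_2 ... P_wn (u_n))). *)
Lemma FMRBA_ind_word (P : F -> Prop) :
  P 0 -> (forall x y, P x -> P y -> P (x + y)) ->
  (forall u x, P x -> P (u • x)) -> P (oneF A Bp) ->
  (forall w x, plus_pure x -> P x -> P (PF w x)) -> forall x, P x.
Proof.
move=> P0 PD PX P1 PP; apply: FMRBA_ind_pure => // u s.
rewrite -[u]mulr1 -FMRBA_scale_pure; apply: (PX).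
elim: s => [|[w v] s IH] //; rewrite -(PF_plus hP).
apply: (PP); first exact: PlusPure.
by rewrite -[AB_incl v]mulr1 -FMRBA_scale_pure; exact: PX.
Qed.

(** Suited to predicates that mention some P_w x, as P_w is not linear over A ⊗ B
and is given by a different formula on each of these three kinds of tensors. *)
Lemma FMRBA_ind_split (P : F -> Prop) :
  P 0 -> (forall x y, P x -> P y -> P (x + y)) ->
  (forall x, plus_pure x -> P x) ->
  (forall a, P (AB_A B a • oneF A Bp)) ->
  (forall a w x, plus_pure x -> P (AB_A B a • PF w x)) ->
  forall x, P x.
Proof.
move=> P0 PD Pp PA PAw; apply: FMRBA_ind_pure => // u s.
rewrite (AB_split augB u) (linD (pure_linear s)); apply: (PD); last first.
  exact/Pp/PlusPure.
case: s => [|[w v] s]; first by rewrite -FMRBA_scale_oneF; exact: PA.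
rewrite -AB_AM1 -FMRBA_scale_pure -(PF_plus hP); apply: (PAw).
exact: PlusPure.
Qed.

Lemma PF_const w a : PF w (AB_A B a • oneF A Bp) = AB_A B (phi w a) • oneF A Bp.
Proof. by rewrite !FMRBA_scale_oneF (PF_A0 hP). Qed.

(** The clause of P_w for heads in A, read as an integration by parts. *)
Lemma PF_scale_PF w a v x : plus_pure x ->
  PF w (AB_A B a • PF v x) =
    AB_A B (phi w a) • PF v x - PF v (AB_A B (phi w a) • x).
Proof.
case=> u s; rewrite !FMRBA_scale_pure !(PF_plus hP) !FMRBA_scale_pure.
by rewrite AB_inclM (PF_plus hP) !AB_AM1 (PF_A hP).
Qed.

(** The Rota-Baxter identity for a in A and any x.  On plus tensors it is the
previous lemma; on the rest of F it comes from the identity of phi on A. *)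
Lemma PF_parts w a v x :
  AB_A B (phi w a) • PF v x =
    PF v (AB_A B (phi w a) • x) + PF w (AB_A B a • PF v x).
Proof.
elim/FMRBA_ind_split: x => [|x y IHx IHy|x xp|b|b v' x xp].
- by rewrite PF_0 !(lin0 (FMRBA_scale_linear _)) !PF_0 addr0.
- by rewrite !(PF_D, FMRBA_scaleDr) IHx IHy addrACA.
- by rewrite PF_scale_PF // addrC subrK.
- rewrite PF_const !FMRBA_scaleA !AB_AM !PF_const -FMRBA_scaleDl phi_RB.
  by rewrite (linD (@AB_A_linear _ _ A B)).
have S c := plus_pure_scale c xp.
rewrite PF_scale_PF // FMRBA_scaleDr FMRBA_scaleNr !FMRBA_scaleA !AB_AM.
rewrite FMRBA_scaleDr FMRBA_scaleNr PF_D PF_N !FMRBA_scaleA !AB_AM.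
rewrite !PF_scale_PF // !FMRBA_scaleA AB_AM.
rewrite phi_RB (linD (@AB_A_linear _ _ A B)) !FMRBA_scaleDl PF_D.
set p := _ • _; set q := _ • _; set r := _ • _; set p' := PF _ _; set q' := PF _ _.
rewrite opprB (addrC p' q') -(addrA q') (addrA _ q') subrK (addrCA q) (addrA _ p').
by rewrite subrK addrA.
Qed.

Section Product.
Variable mul : F -> F -> F.
Hypothesis hm : is_mulF PF mul.

Local Notation "x ⊛ y" := (mul x y) (at level 40, left associativity).

Lemma mulF_Dl x y z : (x + y) ⊛ z = x ⊛ z + y ⊛ z.
Proof. exact: (linD ((mulF_bilinear hm).1 z)). Qed.

Lemma mulF_Dr x y z : x ⊛ (y + z) = x ⊛ y + x ⊛ z.
Proof. exact: (linD ((mulF_bilinear hm).2 x)). Qed.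

Lemma mulF_Nl x y : (- x) ⊛ y = - (x ⊛ y).
Proof. exact: (linN ((mulF_bilinear hm).1 y)). Qed.

Lemma mulF_0l x : 0 ⊛ x = 0.
Proof. exact: (lin0 ((mulF_bilinear hm).1 x)). Qed.

Lemma mulF_0r x : x ⊛ 0 = 0.
Proof. exact: (lin0 ((mulF_bilinear hm).2 x)). Qed.

Lemma mulF_scale u v x y : (u • x) ⊛ (v • y) = (u * v) • (x ⊛ y).
Proof.
elim/FMRBA_ind_pure: x => [|x x' IH IH'|u0 s].
- by rewrite mulF_0l !(lin0 (FMRBA_scale_linear _)) mulF_0l.
- by rewrite mulF_Dl !FMRBA_scaleDr mulF_Dl IH IH'.
elim/FMRBA_ind_pure: y => [|y y' IH IH'|v0 t].
- by rewrite mulF_0r !(lin0 (FMRBA_scale_linear _)) mulF_0r.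
- by rewrite mulF_Dr !FMRBA_scaleDr mulF_Dr IH IH'.
rewrite !FMRBA_scale_pure.
case: s t => [|[w a] s] [|[e b] t].
- by rewrite !(mulF_00 hm) FMRBA_scale_pure mulrACA.
- by rewrite !(mulF_0S hm) FMRBA_scale_pure mulrACA.
- by rewrite !(mulF_S0 hm) FMRBA_scale_pure mulrACA.
by rewrite !(mulF_SS hm) FMRBA_scaleDr !FMRBA_scaleA mulrACA.
Qed.

Lemma mulF_scalel u x y : (u • x) ⊛ y = u • (x ⊛ y).
Proof. by rewrite -[y in LHS]FMRBA_scale1 mulF_scale mulr1. Qed.

Lemma mulF_scaler u x y : x ⊛ (u • y) = u • (x ⊛ y).
Proof. by rewrite -[x in LHS]FMRBA_scale1 mulF_scale mul1r. Qed.

Lemma mulF_1l x : oneF A Bp ⊛ x = x.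
Proof.
move: x; apply: FMRBA_ext => [||u [|y s]]; first exact: (mulF_bilinear hm).2.
- by [].
- by rewrite (mulF_00 hm) mul1r.
by rewrite (mulF_0S hm) mul1r.
Qed.

Lemma mulF_1r x : x ⊛ oneF A Bp = x.
Proof.
move: x; apply: FMRBA_ext => [||u [|y s]]; first exact: (mulF_bilinear hm).1.
- by [].
- by rewrite (mulF_00 hm) mulr1.
by rewrite (mulF_S0 hm) mulr1.
Qed.

(** On plus tensors the recursive clause of the product is the Rota-Baxter
identity. *)
Lemma mulF_plus_RB w x v y : plus_pure x -> plus_pure y ->
  PF w x ⊛ PF v y = PF v (PF w x ⊛ y) + PF w (x ⊛ PF v y).
Proof.
case=> a s [b t]; rewrite ![in LHS](PF_plus hP) (mulF_SS hm) mulr1.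
by rewrite !FMRBA_scale1.
Qed.

(** On values of P the two terms of the recursive clause are exchanged. *)
Lemma mulF_C x y : x ⊛ y = y ⊛ x.
Proof.
elim/FMRBA_ind_word: x y => [|x x' IH IH'|u x IH||w x xp IHx] y.
- by rewrite mulF_0l mulF_0r.
- by rewrite mulF_Dl mulF_Dr IH IH'.
- by rewrite mulF_scalel mulF_scaler IH.
- by rewrite mulF_1l mulF_1r.
elim/FMRBA_ind_word: y => [|y y' IH IH'|u y IH||v y yp IHy].
- by rewrite mulF_0l mulF_0r.
- by rewrite mulF_Dl mulF_Dr IH IH'.
- by rewrite mulF_scalel mulF_scaler IH.
- by rewrite mulF_1l mulF_1r.
by rewrite !mulF_plus_RB // IHy IHx addrC.
Qed.

Definition RB_at w x v y :=
  PF w x ⊛ PF v y = PF v (PF w x ⊛ y) + PF w (x ⊛ PF v y).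

Lemma RB_at_sym w x v y : RB_at w x v y -> RB_at v y w x.
Proof. by rewrite /RB_at addrC !(mulF_C (PF v y)) (mulF_C y). Qed.

(** The essential case is a • P_w' x with x a plus tensor.  Applying P_w gives
phi_w(a) • P_w' x - P_w' (phi_w(a) • x), so that the hypothesis applies to both
products with P_v y; then [PF_parts] is applied to the two summands
P_v (P_w' x y) and P_w' (x P_v y) of P_w' x P_v y. *)
Lemma mulF_RB_left v y : (forall w x, plus_pure x -> RB_at w x v y) ->
  forall w x, RB_at w x v y.
Proof.
move=> RBp w x; rewrite /RB_at.
elim/FMRBA_ind_split: x => [|x x' IH IH'|x xp|a|a w' x xp].
- by rewrite PF_0 !mulF_0l !PF_0 addr0.
- by rewrite !(PF_D, mulF_Dl) IH IH' addrACA.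
- exact: RBp.
- by rewrite PF_const !mulF_scalel !mulF_1l PF_parts.
rewrite PF_scale_PF // !mulF_Dl !mulF_Nl !mulF_scalel.
rewrite RBp // RBp; last exact: plus_pure_scale.
rewrite !mulF_scalel !FMRBA_scaleDr !PF_parts !PF_D PF_N.
rewrite [X in X - _]addrACA [LHS]addrAC; congr (_ + _).
by rewrite [X in _ - X]addrC addrKA.
Qed.

Lemma mulF_RB w x v y :
  PF w x ⊛ PF v y = PF v (PF w x ⊛ y) + PF w (x ⊛ PF v y).
Proof.
apply: mulF_RB_left => {}w {}x xp; apply: RB_at_sym.
by apply: mulF_RB_left => {}v {}y yp; apply: RB_at_sym; exact: mulF_plus_RB.
Qed.

(** For x = P_a x', y = P_b y' and z = P_c z', both sides expand into
P_c ((xy)z') + P_b ((xy')z) + P_a ((x'y)z), up to reassociating products in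
which one factor is smaller. *)
Lemma mulF_A x y z : x ⊛ (y ⊛ z) = x ⊛ y ⊛ z.
Proof.
elim/FMRBA_ind_word: x y z => [|x x' IH IH'|u x IH||a x xp IHx] y z.
- by rewrite !mulF_0l.
- by rewrite !mulF_Dl IH IH'.
- by rewrite !mulF_scalel IH.
- by rewrite !mulF_1l.
elim/FMRBA_ind_word: y z => [|y y' IH IH'|u y IH||b y yp IHy] z.
- by rewrite mulF_0r !mulF_0l mulF_0r.
- by rewrite mulF_Dr !mulF_Dl mulF_Dr IH IH'.
- by rewrite mulF_scaler !mulF_scalel mulF_scaler IH.
- by rewrite mulF_1l mulF_1r.
elim/FMRBA_ind_word: z => [|z z' IH IH'|u z IH||c z zp IHz].
- by rewrite !mulF_0r.
- by rewrite !mulF_Dr IH IH'.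
- by rewrite !mulF_scaler IH.
- by rewrite !mulF_1r.
rewrite (mulF_RB b) mulF_Dr !(mulF_RB a) mulF_Dl !mulF_RB.
(* The summands under PF a on the left, and under PF c on the right, are folded
   back into one product by the Rota-Baxter identity. *)
rewrite addrACA -PF_D -mulF_Dr -mulF_RB IHx IHz IHy.
by rewrite [RHS]addrACA -PF_D -mulF_Dl -mulF_RB addrA.
Qed.

Lemma FMRBA_comalg : comalg_axioms mul (oneF A Bp).
Proof.
split.
- exact: mulF_A.
- exact: mulF_C.
- exact: mulF_1l.
- by move=> x y z; exact: mulF_Dl.
by move=> c x y; rewrite (linZ ((mulF_bilinear hm).1 y)).
Qed.

Lemma jF_mul a x : jF Bp a ⊛ x = AB_A B a • x.
Proof. by rewrite /jF -FMRBA_scale_oneF mulF_scalel mulF_1l. Qed.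

Lemma PFtauE w x :
  PFtau PF mul w x = AB_A B (mt_tau A w) • PF w (AB_A B (mt_tauV A w) • x).
Proof. by rewrite /PFtau !jF_mul. Qed.

Lemma PF_PFtau w x :
  PF w x = AB_A B (mt_tauV A w) • PFtau PF mul w (AB_A B (mt_tau A w) • x).
Proof.
rewrite PFtauE !FMRBA_scaleA !AB_AM (mulrC (mt_tauV A w)) (mtrba_tauV (mtrbaP A)).
by rewrite !FMRBA_scale1.
Qed.

Lemma FMRBA_mtrba : is_mtrba (R := ComAlg FMRBA_comalg) (PFtau PF mul)
  (fun w => jF Bp (mt_tau A w)) (fun w => jF Bp (mt_tauV A w)).
Proof.
have tauK w : AB_A B (mt_tauV A w) * AB_A B (mt_tau A w) = 1.
  by rewrite AB_AM mulrC (mtrba_tauV (mtrbaP A)).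
split.
- move=> w c x y; rewrite !PFtauE (FMRBA_scale_linear _) (PF_linear hP).
  exact: FMRBA_scale_linear.
- move=> w; rewrite -[LHS]/(jF Bp _ ⊛ jF Bp _) (mulF_00 hm) AB_AM.
  by rewrite (mtrba_tauV (mtrbaP A)).
move=> a b x y.
rewrite -[LHS]/(PFtau PF mul a x ⊛ PFtau PF mul b y).
rewrite -[RHS]/(jF Bp (mt_tau A a) ⊛
    PFtau PF mul b (jF Bp (mt_tauV A a) ⊛ PFtau PF mul a x ⊛ y) +
  jF Bp (mt_tau A b) ⊛
    PFtau PF mul a (jF Bp (mt_tauV A b) ⊛ x ⊛ PFtau PF mul b y)).
rewrite !jF_mul !PFtauE !mulF_scalel !mulF_scaler.
rewrite FMRBA_scaleA mulF_RB FMRBA_scaleDr !mulF_scalel !mulF_scaler.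
rewrite !FMRBA_scaleA.
rewrite -!(mulrA (AB_A B (mt_tauV A _))) !tauK !mulr1.
by rewrite (mulrC (AB_A B (mt_tau A b))).
Qed.

End Product.

End Algebra.

(** * The universal property *)

Section Universal.
Variables (K : fieldType) (Omega : choiceType) (A : mtrba K Omega).
Variables (B : comalg K) (Bp : submodClosed B).
Hypothesis augB : augmentation Bp.

Local Notation F := (FMRBA A Bp).
Local Notation L := (letters A Bp).
Local Notation X := (AB A B).

Variables (R : mtrba K Omega) (jR : A -> R) (f : B -> R).
Hypotheses (jR_hom : mtrba_hom jR) (f_hom : alg_hom f).

Definition tens_hom : X -> R := tlift (fun (a : A) (b : B) => (jR a * f b : R)).

Let jR_lin : linear jR. Proof. by case: jR_hom => [[]]. Qed.
Let jR_mul : monoid_morphism jR. Proof. by case: jR_hom => [[]]. Qed.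
Let f_lin : linear f. Proof. by case: f_hom. Qed.
Let f_mul : monoid_morphism f. Proof. by case: f_hom. Qed.

Lemma tens_hom_bil : bilinear_map (fun (a : A) (b : B) => (jR a * f b : R)).
Proof.
split=> [b c x y|a c x y]; first by rewrite jR_lin mulrDl -calg_scalerAl.
by rewrite f_lin mulrDr -calg_scalerAr.
Qed.

Lemma tens_hom_linear : linear tens_hom.
Proof. exact: (tlift_linear tens_hom_bil). Qed.

Lemma tens_homE (a : A) (b : B) : tens_hom (a ⊗ b) = jR a * f b.
Proof. exact: (tliftE tens_hom_bil). Qed.

Lemma tens_hom_A a : tens_hom (AB_A B a) = jR a.
Proof. by rewrite tens_homE f_mul.1 mulr1. Qed.

Lemma tens_hom1 : tens_hom 1 = 1.
Proof. by rewrite -[1]/(AB_A B 1) tens_hom_A jR_mul.1. Qed.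

Lemma tens_homM u v : tens_hom (u * v) = tens_hom u * tens_hom v.
Proof.
elim/tens_ind: u => [|a b u IH].
  by rewrite [0 * v](mul0r v) !(lin0 tens_hom_linear) mul0r.
rewrite [(_ + _) * v](mulrDl (a ⊗ b : X) u v) !(linD tens_hom_linear) mulrDl IH.
congr (_ + _) => {u IH}; elim/tens_ind: v => [|c d v IH].
  by rewrite [_ * 0](mulr0 (a ⊗ b : X)) !(lin0 tens_hom_linear) mulr0.
rewrite [_ * (_ + _)](mulrDr (a ⊗ b : X)) !(linD tens_hom_linear) mulrDr IH.
congr (_ + _); rewrite [X in tens_hom X]tens_mulE !tens_homE jR_mul.2 f_mul.2.
by rewrite mulrACA.
Qed.

Let E w (u : AB_plus A Bp) (r : R) : R := phi w (tens_hom (AB_incl u) * r).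

Lemma hom_letter_bil w : bilinear_map (E w).
Proof.
split=> [r|u] c x y; rewrite /E.
  rewrite (AB_incl_linear _) tens_hom_linear mulrDl -calg_scalerAl.
  exact: phi_linear.
by rewrite mulrDr -calg_scalerAr; exact: phi_linear.
Qed.

(** The value forced on 1 ⊗ t by compatibility with the operators. *)
Fixpoint word_hom k : tpow L k -> R :=
  match k return tpow L k -> R with
  | 0 => fun c => (c : K) *: (1 : R)
  | j.+1 => tlift (fun (p : L) (t : tpow L j) => letter_lift E p (word_hom t))
  end.

Lemma word_hom_bil k : linear (@word_hom k) ->
  bilinear_map (fun (p : L) (t : tpow L k) => letter_lift E p (word_hom t)).
Proof.
move=> kl; split=> [t|p]; first exact: ((letter_lift_bil hom_letter_bil).1 _).
exact: linear_comp ((letter_lift_bil hom_letter_bil).2 _) kl.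
Qed.

Lemma word_hom_linear k : linear (@word_hom k).
Proof.
elim: k => [|k IH]; last exact: (tlift_linear (word_hom_bil IH)).
by move=> c x y; rewrite /= scalerDl scalerA.
Qed.

Lemma word_homS w u s :
  word_hom (word ((w, u) :: s)) = phi w (tens_hom (AB_incl u) * word_hom (word s)).
Proof.
rewrite /= (tliftE (word_hom_bil (@word_hom_linear _))).
exact: (letter_liftE hom_letter_bil).
Qed.

Definition free_hom : F -> R :=
  Flift (fun k (u : X) (t : tpow L k) => (tens_hom u * word_hom t : R)).

Lemma free_hom_bil k :
  bilinear_map (fun (u : X) (t : tpow L k) => (tens_hom u * word_hom t : R)).
Proof.
split=> [t|u] c x y; first by rewrite tens_hom_linear mulrDl -calg_scalerAl.
by rewrite word_hom_linear mulrDr -calg_scalerAr.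
Qed.

Lemma free_hom_linear : linear free_hom.
Proof. exact: (Flift_linear free_hom_bil). Qed.

Lemma free_hom_pure u s : free_hom (pure u s) = tens_hom u * word_hom (word s).
Proof. exact: (Flift_pure free_hom_bil). Qed.

Lemma free_hom1 : free_hom (oneF A Bp) = 1.
Proof. by rewrite free_hom_pure tens_hom1 mul1r /= scale1r. Qed.

Lemma free_hom_scale u x : free_hom (u • x) = tens_hom u * free_hom x.
Proof.
elim/FMRBA_ind_pure: x => [|x y IHx IHy|v s].
- by rewrite (lin0 (FMRBA_scale_linear _)) (lin0 free_hom_linear) mulr0.
- by rewrite FMRBA_scaleDr !(linD free_hom_linear) mulrDr IHx IHy.
by rewrite FMRBA_scale_pure !free_hom_pure tens_homM mulrA.
Qed.

Variable PF : Omega -> F -> F.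
Hypothesis hP : is_PF PF.

Lemma free_hom_PF_plus w x :
  plus_pure x -> free_hom (PF w x) = phi w (free_hom x).
Proof.
case=> u s; rewrite (PF_plus hP) !free_hom_pure word_homS tens_hom1.
exact: mul1r.
Qed.

(** Inverses are unique, so a morphism preserves them although only the twist
itself is required to be preserved. *)
Lemma hom_tauV w : jR (mt_tauV A w) = mt_tauV R w.
Proof.
rewrite -[LHS]mulr1 -(mtrba_tauV (mtrbaP R) w) mulrA.
have [_ <- _] := jR_hom; rewrite -jR_mul.2 mulrC.
by rewrite [_ * mt_tau A w]mulrC (mtrba_tauV (mtrbaP A)) jR_mul.1 mulr1.
Qed.

Lemma hom_phi w a : jR (phi w a) = phi w (jR a).
Proof.
have [_ jt jop] := jR_hom.
by rewrite /phi !jR_mul.2 hom_tauV jop jR_mul.2 jt.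
Qed.

(** On a • P_v x this is the Rota-Baxter identity of the target between jR a and
the image of x. *)
Lemma free_hom_PF w x : free_hom (PF w x) = phi w (free_hom x).
Proof.
have hD := linD free_hom_linear; have hN := linN free_hom_linear.
elim/(FMRBA_ind_split augB hP): x => [|x y IHx IHy|x xp|a|a v x xp].
- rewrite (PF_0 hP) !(lin0 free_hom_linear).
  by rewrite (lin0 (@phi_linear _ _ R w)).
- by rewrite (PF_D hP) !hD (linD (@phi_linear _ _ R w)) IHx IHy.
- exact: free_hom_PF_plus.
- rewrite (PF_const hP) !free_hom_scale free_hom1 !mulr1 !tens_hom_A.
  exact: hom_phi.
rewrite (PF_scale_PF hP) // hD hN !free_hom_scale !tens_hom_A.
rewrite !free_hom_PF_plus ?free_hom_scale ?tens_hom_A //; last first.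
  exact: plus_pure_scale.
by rewrite hom_phi phi_RB addrC addKr.
Qed.

Variable mul : F -> F -> F.
Hypothesis hm : is_mulF PF mul.

Lemma free_homM x y : free_hom (mul x y) = free_hom x * free_hom y.
Proof.
have hD := linD free_hom_linear.
elim/(FMRBA_ind_word hP): x y => [|x x' IH IH'|u x IH||w x xp IHx] y.
- by rewrite (mulF_0l hm) (lin0 free_hom_linear) mul0r.
- by rewrite (mulF_Dl hm) !hD mulrDl IH IH'.
- by rewrite (mulF_scalel hm) !free_hom_scale IH mulrA.
- by rewrite (mulF_1l hm) free_hom1 mul1r.
elim/(FMRBA_ind_word hP): y => [|y y' IH IH'|u y IH||v y yp IHy].
- by rewrite (mulF_0r hm) (lin0 free_hom_linear) mulr0.
- by rewrite (mulF_Dr hm) !hD mulrDr IH IH'.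
- by rewrite (mulF_scaler hm) !free_hom_scale IH mulrCA.
- by rewrite (mulF_1r hm) free_hom1 mulr1.
rewrite (mulF_plus_RB hP hm) // hD !free_hom_PF IHy IHx !free_hom_PF.
by rewrite [RHS]phi_RB.
Qed.

End Universal.

Section Freeness.
Variables (K : fieldType) (Omega : choiceType) (A : mtrba K Omega).
Variables (B : comalg K) (Bp : submodClosed B).
Hypothesis augB : augmentation Bp.

Local Notation F := (FMRBA A Bp).

Variables (PF : Omega -> F -> F) (mul : F -> F -> F).
Hypotheses (hP : is_PF PF) (hm : is_mulF PF mul).

Let alg_F : comalg K := ComAlg (FMRBA_comalg augB hP hm).
Let mt_F : mtrba K Omega := Mtrba (FMRBA_mtrba augB hP hm).

Lemma jF_hom : mtrba_hom (R := A) (S := mt_F) (fun a => jF Bp a).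
Proof.
split; [split|by []|].
- by move=> c x y; rewrite /jF (@AB_A_linear _ _ A B) (pure_linear _).
- split=> // x y; rewrite -[RHS]/(mul (jF Bp x) (jF Bp y)).
  by rewrite (mulF_00 hm) AB_AM.
by move=> w a; rewrite -[RHS]/(PFtau PF mul w (jF Bp a)) (PFtau_A0 hP hm).
Qed.

Lemma iF_hom : alg_hom (R := B) (S := alg_F) (fun b => iF A Bp b).
Proof.
split=> [c x y|].
  by rewrite /iF tpairDr tpairZr (pure_linear (A := A) (Bp := Bp)).
split=> // x y; rewrite -[RHS]/(mul (iF A Bp x) (iF A Bp y)) (mulF_00 hm).
by rewrite [X in _ = pure X _]tens_mulE mulr1.
Qed.

(** The values on A ⊗ B are those of jR ⊗ f, hence g is semilinear over A ⊗ B, and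
commuting with the twisted operators amounts to commuting with P. *)
Lemma free_hom_unique (R : mtrba K Omega) (jR : A -> R) (f : B -> R) :
  mtrba_hom jR -> alg_hom f -> forall g : mt_F -> R, mtrba_hom g ->
  (forall a, g (jF Bp a) = jR a) -> (forall b, f b = g (iF A Bp b)) ->
  g =1 free_hom (Bp := Bp) jR f.
Proof.
move=> hj hf g [[gl gm] gt gP] gj gi.
have gM x y : g (mul x y) = g x * g y by exact: gm.2.
have hl := free_hom_linear (Bp := Bp) hj hf.
have gX (u : AB A B) : g (pure u [::]) = tens_hom jR f u.
  move: u; apply: (@tens_ext K A B).
  - exact: (linear_comp gl (pure_linear _)).
  - exact: tens_hom_linear hj hf.
  move=> a b; rewrite (tens_homE hj hf) -gj gi -gM (mulF_00 hm).
  by rewrite [X in _ = g (pure X _)]tens_mulE mulr1 mul1r.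
have gS u x : g (FMRBA_scale u x) = tens_hom jR f u * g x.
  rewrite -gX -gM -FMRBA_scale_oneF (mulF_scalel hm).
  by rewrite (mulF_1l hm).
elim/(FMRBA_ind_word hP) => [|x y IHx IHy|u x IH||w x _ IH].
- by rewrite (lin0 gl) (lin0 hl).
- by rewrite (linD gl) (linD hl) IHx IHy.
- by rewrite gS (free_hom_scale hj hf) IH.
- by rewrite [LHS]gm.1 (free_hom1 _ hj hf).
rewrite (free_hom_PF augB hj hf hP) -IH (PF_PFtau hm) gS.
rewrite -[PFtau _ _ _ _]/(mt_op (m := mt_F) w _) gP gS !(tens_hom_A hj hf).
have [[_ jm] jt _] := hj.
rewrite /phi jt; congr (_ * _).
exact: hom_tauV.
Qed.

End Freeness.

Theorem theorem4p5 (K : fieldType) (char0 : [pchar K] =i pred0)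
    (Omega : choiceType) (Omega_ne : inhabited Omega) (A : mtrba K Omega)
    (B : comalg K) (Bp : submodClosed B) (augB : augmentation Bp) :
  (exists PF : Omega -> FMRBA A Bp -> FMRBA A Bp,
     is_PF PF /\ exists mul, is_mulF PF mul) /\
  forall (PF : Omega -> FMRBA A Bp -> FMRBA A Bp)
         (mul : FMRBA A Bp -> FMRBA A Bp -> FMRBA A Bp),
    is_PF PF -> is_mulF PF mul ->
    exists (algF : comalg_axioms mul (oneF A Bp))
           (mtrbaF : is_mtrba (R := ComAlg algF) (PFtau PF mul)
                       (fun w => jF Bp (mt_tau A w))
                       (fun w => jF Bp (mt_tauV A w))),
      is_free_mtrba (A := A) (B := B) (F := Mtrba mtrbaF)
        (fun a => jF Bp a) (fun b => iF A Bp b).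
Proof.
split.
  exists (PF_map augB); split; first exact: PF_mapP.
  by exists (shuffle_mul (PF_map augB)); apply: shuffle_mulP; exact: PF_mapP.
move=> PF mul hP hm; exists (FMRBA_comalg augB hP hm), (FMRBA_mtrba augB hP hm).
split; [exact: jF_hom|exact: iF_hom|].
move=> R jR hj f hf; exists (free_hom (Bp := Bp) jR f); split; last first.
  move=> g [hg gj gi]; apply: funext => x; apply/esym.
  exact: (free_hom_unique hj hf hg gj gi).
have hjF a : free_hom (Bp := Bp) jR f (jF Bp a) = jR a.
  by rewrite (free_hom_pure hj hf) (tens_hom_A hj hf) /= scale1r mulr1.
have [[_ jm] jt _] := hj.
split=> [||b]; first split; first split.
- exact: free_hom_linear.
- split; first exact: free_hom1.
  exact: (free_homM augB hj hf hP hm).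
- by move=> w; rewrite -jt; exact: hjF.
- move=> w x; rewrite -[mt_op _ _]/(PFtau PF mul w x) (PFtauE hm).
  rewrite (free_hom_scale hj hf) (free_hom_PF augB hj hf hP).
  rewrite (free_hom_scale hj hf) !(tens_hom_A hj hf) jt (hom_tauV hj) /phi.
  by rewrite !mulrA !(mtrba_tauV (mtrbaP R)) !mul1r.
- exact: hjF.
rewrite (free_hom_pure hj hf) (tens_homE hj hf) jm.1 mul1r /=.
by rewrite scale1r mulr1.
Qed.
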